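(* If $X\subset[0,1]$ is the classical (middle-thirds) Cantor set, then $C_\infty(X)\cong s$.
   Context: $s=\{x=(x_0,x_1,\dots): \lim_n x_n n^k=0 \text{ for all } k\in\mathbb{N}\}$ is the space of rapidly decreasing scalar sequences, a nuclear Fréchet space with the norms $\|x\|_k=\sup_n |x_n|(n+1)^k$. $C_\infty(X):=\{f|_X: f\in C^\infty[0,1]\}=\{f|_X: f\in C^\infty(\mathbb{R})\}$, equipped with the quotient topology, i.e. the topology of the quotient of the Fréchet space $C^\infty[0,1]$ (uniform convergence of all derivatives) by the closed subspace of functions vanishing on $X$. Functions take values in the same scalar field ($\mathbb{R}$ or $\mathbb{C}$) as the sequences in $s$. The symbol $\cong$ means linear topological isomorphism of Fréchet spaces. *)

(* Defs.v *)
From HB Require Import structures.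
From mathcomp Require Import all_boot all_order all_algebra.
From mathcomp Require Import complex.
From mathcomp Require Import all_classical all_reals all_analysis.

Set Implicit Arguments.
Unset Strict Implicit.
Unset Printing Implicit Defensive.

Import Order.TTheory GRing.Theory Num.Theory.
Import numFieldNormedType.Exports.

Local Open Scope classical_set_scope.
Local Open Scope ring_scope.

(** Real or complex scalars.  [numFieldType] norms take their values in the
    field itself, hence the separate real-valued [modulus]. *)
Record scalarField (R : realType) := ScalarField {
  scalar :> numFieldType ;
  of_real : {rmorphism R -> scalar} ;
  modulus : scalar -> R ;
  modulusE : forall z : scalar, of_real (modulus z) = `|z| }.

Definition real_scalars (R : realType) : scalarField R :=
  @ScalarField R R idfun Num.norm (fun=> erefl).

Definition complex_scalars (R : realType) : scalarField R :=
  @ScalarField R R[i] (real_complex R) (@ComplexField.Normc.normc R)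
    (fun=> erefl).

(** The topology generated by a sequence [p] of seminorms. *)
Section seminorm_topology.
Context {R : realType} {E : zmodType} (p : nat -> E -> R).

Definition seminorm_open (A : set E) : Prop :=
  forall x, A x -> exists k : nat, exists2 e : R, 0 < e &
    forall y, (forall j, (j <= k)%N -> p j (y - x) < e) -> A y.

Lemma seminorm_openT : seminorm_open setT.
Proof. by move=> x _; exists 0%N, 1. Qed.

Lemma seminorm_openI (A B : set E) :
  seminorm_open A -> seminorm_open B -> seminorm_open (A `&` B).
Proof.
move=> oA oB x [Ax Bx].
have [k [e e0 kA]] := oA _ Ax; have [l [d d0 lB]] := oB _ Bx.
exists (maxn k l), (Num.min e d); first by rewrite lt_min e0.
move=> y yp; split.
- apply: kA => j jk; have := yp j (leq_trans jk (leq_maxl _ _)).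
  by rewrite lt_min => /andP[].
- apply: lB => j jl; have := yp j (leq_trans jl (leq_maxr _ _)).
  by rewrite lt_min => /andP[].
Qed.

Lemma seminorm_open_bigU (I : Type) (f : I -> set E) :
  (forall i, seminorm_open (f i)) -> seminorm_open (\bigcup_i f i).
Proof.
move=> fo x [i _ fix_]; have [k [e e0 ke]] := fo i x fix_.
by exists k, e => // y /ke fy; exists i.
Qed.

End seminorm_topology.

Section rapidly_decreasing.
Context {R : realType} (K : scalarField R).

Definition rapidly_decreasing : {pred nat -> K} :=
  fun x => `[< forall k : nat, (fun n => x n * n%:R ^+ k) @ \oo --> (0 : K) >].

Lemma rapidly_decreasing_submod : submod_closed rapidly_decreasing.
Proof.
split=> [|a x y /asboolP xs /asboolP ys]; apply/asboolP => k.
  rewrite (_ : (fun n => _) = cst 0); first exact: cvg_cst.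
  by apply/funext => n; rewrite mul0r.
rewrite (_ : (fun n => _) =
    (fun n => a * (x n * n%:R ^+ k) + y n * n%:R ^+ k)); last first.
  by apply/funext => n; rewrite mulrDl mulrA.
rewrite -[X in _ --> X]addr0; apply: cvgD (ys k).
by rewrite -[X in _ --> X](mulr0 a); apply: cvgMr.
Qed.

HB.instance Definition _ :=
  GRing.isSubmodClosed.Build K (nat -> K) rapidly_decreasing
    rapidly_decreasing_submod.

Record s_space := SSpace {
  s_seq :> nat -> K ; _ : s_seq \in rapidly_decreasing }.

HB.instance Definition _ := [isSub for s_seq].
HB.instance Definition _ := [Choice of s_space by <:].
HB.instance Definition _ := [SubChoice_isSubLmodule of s_space by <:].

Definition s_norm (k : nat) (x : s_space) : R :=
  sup (range (fun n : nat => modulus (x n) * n.+1%:R ^+ k)).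

HB.instance Definition _ := isOpenTopological.Build s_space
  (seminorm_openT s_norm) (@seminorm_openI _ _ s_norm)
  (@seminorm_open_bigU _ _ s_norm).

End rapidly_decreasing.

(** [C^oo[0,1]]: its elements are functions on the interval only, with
    one-sided derivatives at the endpoints. *)
Section smooth_functions.
Context {R : realType}.

Definition unit_interval : Type := set_type (`[0, 1]%classic : set R).
HB.instance Definition _ := Topological.on unit_interval.

Lemma unit_interval_other_point (u e : R) : 0 <= u <= 1 -> 0 < e ->
  exists y, [/\ 0 <= y <= 1, `|u - y| < e & y != u].
Proof.
move=> /andP[u0 u1] e0; pose d := Num.min e 1 / 2.
have m0 : 0 < Num.min e 1 by rewrite lt_min e0 ltr01.
have d0 : 0 < d by rewrite divr_gt0.
have dlt : d < Num.min e 1 by rewrite gtr_pMr// invf_lt1 ?ltr1n.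
have de : d < e by move: dlt; rewrite lt_min => /andP[].
have d2 : d <= 1 / 2 by rewrite ler_pM2r ?invr_gt0// ge_min lexx orbT.
have E2 : 1 = (1 / 2 : R) + 1 / 2 by rewrite -splitr.
have [uh|uh] := leP u (1 / 2).
- exists (u + d); split.
  + by rewrite addr_ge0 ?(ltW d0)//= [leRHS]E2 lerD.
  + by rewrite opprD addNKr normrN gtr0_norm.
  + by rewrite -subr_eq0 addrAC subrr add0r gt_eqF.
- exists (u - d); split.
  + rewrite subr_ge0 (le_trans d2 (ltW uh))/=.
    by rewrite lerBlDr (le_trans u1)// lerDl ltW.
  + by rewrite opprB addrC subrK gtr0_norm.
  + by rewrite -subr_eq0 addrAC subrr add0r oppr_eq0 gt_eqF.
Qed.

Global Instance unit_interval_dnbhs_proper (x : unit_interval) :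
  ProperFilter x^'.
Proof.
split; last exact: dnbhs_filter.
case=> B [[U oU UB] Bx] Bsub.
have : nbhs (set_val x) U.
  by apply: open_nbhs_nbhs; split => //; have : B x := Bx; rewrite -UB.
move=> /nbhs_ballP[e /= e0 eU].
have x01 : 0 <= set_val x <= 1 by have := set_valP x; rewrite /= in_itv.
have [y [y01 xy yx]] := unit_interval_other_point x01 e0.
have yI : (`[0, 1]%classic : set R) y by rewrite /= in_itv.
apply: (Bsub (SigSub (mem_set yI) : unit_interval)).
  by rewrite -UB /=; apply: eU.
by apply: contra_neq yx => <-.
Qed.

Context (K : scalarField R).
Implicit Types f : unit_interval -> K.

Definition diff_quotient f (x y : unit_interval) : K :=
  (f y - f x) / of_real K (set_val y - set_val x).

(** Meaningful only when [f] is differentiable. *)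
Definition deriv01 f (x : unit_interval) : K := lim (diff_quotient f x @ x^').

Definition derivn01 (n : nat) f : unit_interval -> K := iter n deriv01 f.

Definition smooth01 : {pred unit_interval -> K} :=
  fun f => `[< forall (n : nat) (x : unit_interval),
                 cvg (diff_quotient (derivn01 n f) x @ x^') >].

Lemma diff_quotientD (a : K) f g x :
  diff_quotient (a *: f + g) x =
    a *: diff_quotient f x + diff_quotient g x.
Proof.
apply/funext => y; rewrite /diff_quotient !fctE /= opprD addrACA mulrDl.
by rewrite -scalerBr -scalerAl.
Qed.

Lemma derivn01D (a : K) f g n : f \in smooth01 -> g \in smooth01 ->
  derivn01 n (a *: f + g) = a *: derivn01 n f + derivn01 n g.
Proof.
move=> /asboolP fs /asboolP gs; elim: n => [//|n IH].
apply/funext => x; rewrite /derivn01 /= -!/(derivn01 _ _) IH /deriv01.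
rewrite diff_quotientD limD; [|exact: is_cvgZl_tmp|exact: gs].
by rewrite limZl_tmp.
Qed.

Lemma smooth01_submod : submod_closed smooth01.
Proof.
split=> [|a f g fs gs]; apply/asboolP => n x.
  have -> : derivn01 n 0 = 0.
    elim: n => // n; rewrite /derivn01 /= => ->.
    apply/funext => y; rewrite /deriv01 (_ : diff_quotient _ _ = cst 0).
      exact: lim_cst.
    by apply/funext => z; rewrite /diff_quotient subrr mul0r.
  rewrite (_ : diff_quotient _ _ = cst 0); first exact: is_cvg_cst.
  by apply/funext => z; rewrite /diff_quotient subrr mul0r.
rewrite derivn01D // diff_quotientD.
move/asboolP: fs => fs; move/asboolP: gs => gs.
by apply: is_cvgD; [exact: is_cvgZl_tmp|exact: gs].
Qed.

HB.instance Definition _ :=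
  GRing.isSubmodClosed.Build K (unit_interval -> K) smooth01 smooth01_submod.

Record smooth_fun := SmoothFun {
  smooth_val :> unit_interval -> K ; _ : smooth_val \in smooth01 }.

HB.instance Definition _ := [isSub for smooth_val].
HB.instance Definition _ := [Choice of smooth_fun by <:].
HB.instance Definition _ := [SubChoice_isSubLmodule of smooth_fun by <:].

Definition smooth_seminorm (k : nat) (f : smooth_fun) : R :=
  sup (range (fun x : unit_interval => modulus (derivn01 k f x))).

HB.instance Definition _ := isOpenTopological.Build smooth_fun
  (seminorm_openT smooth_seminorm) (@seminorm_openI _ _ smooth_seminorm)
  (@seminorm_open_bigU _ _ smooth_seminorm).

End smooth_functions.
Arguments unit_interval R : clear implicits.

(** The restrictions to [X] of the smooth functions on [[0,1]]. *)
Section restrictions.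
Context {R : realType} (K : scalarField R) (X : set (unit_interval R)).

Definition restriction (f : unit_interval R -> K) : X -> K :=
  fun x => f (set_val x).

Definition smooth_restriction : {pred X -> K} :=
  fun g => `[< exists f : smooth_fun K, g = restriction f >].

Lemma smooth_restriction_submod : submod_closed smooth_restriction.
Proof.
split=> [|a g h /asboolP[f ->] /asboolP[k ->]].
  by apply/asboolP; exists 0; apply/funext.
by apply/asboolP; exists (a *: f + k); apply/funext.
Qed.

HB.instance Definition _ :=
  GRing.isSubmodClosed.Build K (X -> K) smooth_restriction
    smooth_restriction_submod.

Record C_infty := CInfty {
  C_infty_val :> X -> K ; _ : C_infty_val \in smooth_restriction }.

HB.instance Definition _ := [isSub for C_infty_val].
HB.instance Definition _ := [Choice of C_infty by <:].
HB.instance Definition _ := [SubChoice_isSubLmodule of C_infty by <:].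

Lemma restriction_in (f : smooth_fun K) :
  restriction f \in smooth_restriction.
Proof. by apply/asboolP; exists f. Qed.

(** The quotient map: it is linear and onto, and its kernel is the space of
    the functions vanishing on [X]. *)
Definition to_C_infty (f : smooth_fun K) : C_infty := CInfty (restriction_in f).

Definition C_infty_open (U : set C_infty) : Prop := open (to_C_infty @^-1` U).

Lemma C_infty_openT : C_infty_open setT.
Proof. by rewrite /C_infty_open preimage_setT; exact: openT. Qed.

Lemma C_infty_openI (U V : set C_infty) :
  C_infty_open U -> C_infty_open V -> C_infty_open (U `&` V).
Proof. by move=> oU oV; rewrite /C_infty_open preimage_setI; exact: openI. Qed.

Lemma C_infty_open_bigU (I : Type) (F : I -> set C_infty) :
  (forall i, C_infty_open (F i)) -> C_infty_open (\bigcup_i F i).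
Proof.
move=> oF; rewrite /C_infty_open preimage_bigcup.
by apply: bigcup_open => i _; exact: oF.
Qed.

HB.instance Definition _ := isOpenTopological.Build C_infty
  C_infty_openT C_infty_openI C_infty_open_bigU.

End restrictions.

Definition linearly_homeomorphic (K : numFieldType)
    (E F : preTopologicalLmodType K) : Prop :=
  exists (T : {linear E -> F}) (S : {linear F -> E}),
    [/\ cancel T S, cancel S T, continuous T & continuous S].

Fixpoint cantor_step {R : realType} (n : nat) : set R :=
  if n is m.+1 then
    [set x / 3 | x in cantor_step m] `|` [set (2 + x) / 3 | x in cantor_step m]
  else `[0, 1]%classic.

Definition cantor_set {R : realType} : set R := \bigcap_n cantor_step n.

(** The Cantor set, as a subset of the type of points of [[0,1]]. *)
Definition cantor01 (R : realType) : set (unit_interval R) :=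
  [set x | cantor_set (set_val x)].
Arguments cantor01 R : clear implicits.

(* Main.v *)
From HB Require Import structures.
Require Import Defs.
From mathcomp Require Import all_boot all_order all_algebra.
From mathcomp Require Import complex ring lra zify.
From mathcomp Require Import all_classical all_reals all_analysis.

Set Implicit Arguments.
Unset Strict Implicit.
Unset Printing Implicit Defensive.

Import Order.TTheory GRing.Theory Num.Theory.
Import numFieldNormedType.Exports.

Local Open Scope classical_set_scope.
Local Open Scope ring_scope.

(** Let [X] be the Cantor set.  The isomorphism is given by an explicit Schauder
    basis of [C_infty X], obtained by Newton interpolation at a sequence
    [z_0, z_1, ...] of points of [X].

    The points are the left endpoints of the intervals of the construction of
    [X], in bit-reversed order: [z_(2j+b) = (2b + z_j)/3].  They inherit the
    self-similarity of [X]: for [J < 2^n] the points [z_(J + 2^n i)] are the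
    images of the [z_i] under the affine map of [X] onto its [J]-th piece of
    length [3^-n] ([node_shift]).  To an index [m] one attaches a stage
    [n = stage m], a piece [J = m mod 2^n] and a degree [q = m div 2^n].  The
    basis function [e_m] vanishes on the other pieces of level [n], and on the
    [J]-th one it is the product of the [(u - z_i)/(z_q - z_i)], [i < q], in the
    variable [u] that rescales the piece to [X].  Then [e_m(z_l) = 0] for
    [l < m] and [e_m(z_m) = 1].  This triangularity attaches to a function [v] on
    the nodes one and only one formal expansion [sum c_m e_m] with the right
    values, in which [c_m] depends on [v(z_0), ..., v(z_m)] only ([coef]).

    Two estimates turn the formal expansion into an isomorphism.

    Growth of the basis.  A smooth plateau function extends [e_m] to [[0,1]].
    Rescaling by [3^n] multiplies the [k]-th derivative by [3^(nk)], which is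
    polynomial in [m] because [2^n <= 2(m+1)] ([basis_tower_le]).  So
    [sum x_m e_m] converges in [C^oo[0,1]] for [x] in [s], and depends
    continuously on [x] ([expansion_le]).

    Decay of the coefficients.  Let [d_n] be the number of nodes per piece at
    stage [n].  On a piece of level [n] the partial sum over the stages up to [n]
    is the polynomial of degree less than [d_n] that interpolates the function at
    [d_n] nodes.  Compared with a Taylor polynomial of order [k <= d_n], whose
    error on a set of diameter [3^-n] is of size [3^(-nk)], it shows that a
    coefficient of the next stage is at most [3^(-nk)] times the [k]-th seminorm
    of the function times two Lebesgue constants ([coef_le],
    [coef_samples_le]).  Since [m + 1 <= 4^n] for [n = stage m], this is rapid
    decay.

    The Lebesgue constants and the derivatives of the rescaled profiles depend on
    the degrees in a way that need not be computed: the [d_n] tend to infinity so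
    slowly that all these constants are [O(2^n)] ([slow], [exists_thresholds]).

    A smooth function and the sum of its expansion agree at the nodes, which are
    dense in [X], so they agree on [X] ([smooth_eq_on_cantor]); and an expansion
    recovers its own coefficients by triangularity ([coef_expansion]).

    The real and the complex case are one argument over scalars whose moduli
    behave as expected ([admissible_scalars]); in particular the mean value
    inequality is proved without reference to coordinates. *)

(** * Smooth functions of a real variable and a plateau function *)

Section smooth_real_functions.
Context {R : realType}.
Implicit Types (f g : R -> R) (x : R).

(** Derivatives are existentially quantified, so that closure under products and
    inverses follows by induction from the Leibniz rule alone, without any
    formula for higher derivatives. *)
Fixpoint diffn n f : Prop :=
  if n is m.+1 then
    exists2 g : R -> R, (forall x, is_derive x (1 : R) f (g x)) & diffn m g
  else True.

Definition smoothR f := forall n, diffn n f.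

Lemma diffnS n f : diffn n.+1 f -> diffn n f.
Proof.
elim: n f => //= n IH f [g fg gn]; exists g => //; exact: IH.
Qed.

Lemma diffn_cst n c : diffn n (cst c).
Proof.
elim: n c => //= n IH c; exists (cst 0) => // x; exact: is_derive_cst.
Qed.

Lemma diffnD n f g : diffn n f -> diffn n g -> diffn n (f + g).
Proof.
elim: n f g => //= n IH f g [f' ff' f'n] [g' gg' g'n].
exists (f' + g'); last exact: IH.
by move=> x; apply: is_deriveD.
Qed.

Lemma diffnM n f g : diffn n f -> diffn n g -> diffn n (f * g).
Proof.
elim: n f g => //= n IH f g fn gn.
have fn' : diffn n f by apply: diffnS.
have gn' : diffn n g by apply: diffnS.
move: fn gn => [f' ff' f'n] [g' gg' g'n].
exists (f * g' + g * f'); last by apply: diffnD; apply: IH.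
by move=> x; apply: is_deriveM.
Qed.

(** The derivative of [1/f] is again built from [f'] and [1/f], so the induction
    on the order of differentiability feeds itself. *)
Lemma diffnV n f : (forall x, f x != 0) -> diffn n f ->
  diffn n (fun x => (f x)^-1).
Proof.
move=> f0; elim: n => //= n IH fn.
have fn' : diffn n f by apply: diffnS.
move: fn => [f' ff' f'n].
exists (cst (-1) * ((fun x => (f x)^-1) * (fun x => (f x)^-1)) * f').
  move=> x; have := is_deriveV (f0 x) (ff' x).
  rewrite (_ : - _ *: _ = (cst (-1) * ((fun x => (f x)^-1) * (fun x => (f x)^-1)) * f') x) //.
  by rewrite !fctE /= /GRing.scale/= mulN1r expr2 invfM.
by apply: diffnM => //; apply: diffnM; [exact: diffn_cst|apply: diffnM; exact: IH].
Qed.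

Lemma diffn_affine n f (a b : R) : diffn n f -> diffn n (fun x => f (a * x + b)).
Proof.
elim: n f => //= n IH f [g fg gn].
exists (cst a * (fun x => g (a * x + b))); last first.
  by apply: diffnM; [exact: diffn_cst|exact: IH].
move=> x; have h : is_derive x (1:R) (fun x => a * x + b) a.
  have h0 := @is_deriveZ _ _ _ (@id R) a x 1 1 (is_derive_id x 1).
  have := is_deriveD h0 (is_derive_cst b x 1).
  by rewrite addr0 /GRing.scale /= mulr1.
have := @is_derive1_comp _ f (fun x => a * x + b) x _ _ (fg (a * x + b)) h.
by rewrite mulrC.
Qed.

Lemma diffn_horner n (p : {poly R}) : diffn n (horner p).
Proof.
elim: n p => //= n IH p; exists (horner p^`()); last exact: IH.
by move=> x; exact: is_derive_poly.
Qed.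

Lemma is_derive_flat0 f (C : R) : (forall x, `|f x| <= C * x ^+ 2) ->
  is_derive (0 : R) 1 f 0.
Proof.
move=> fC.
have f0 : f 0 = 0.
  by apply/normr0_eq0/le_anti; rewrite normr_ge0 andbT (le_trans (fC 0))// expr0n mulr0.
apply/is_derive1_caratheodory; exists (fun x => f x / x); split.
- move=> z; rewrite f0 !subr0; have [->|z0] := eqVneq z 0.
    by rewrite f0 mulr0.
  by rewrite mulfVK.
- change ((fun z : R => f z / z) @ (0 : R) --> f 0 / 0); rewrite invr0 mulr0.
  apply/cvgr0Pnorm_le => /= e e0.
  have C1 : 0 < `|C| + 1 by rewrite ltr_wpDl.
  near=> z.
  have [->|z0] := eqVneq z 0; first by rewrite invr0 mulr0 normr0 ltW.
  rewrite normrM normfV ler_pdivrMr ?normr_gt0//.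
  apply: le_trans (fC z) _.
  rewrite -real_normK ?num_real// expr2 mulrA ler_pM2r ?normr_gt0//.
  rewrite (@le_trans _ _ ((`|C| + 1) * `|z|))//.
    rewrite ler_wpM2r// (le_trans (ler_norm C))// lerDl//.
  rewrite -ler_pdivlMl//.
  have : ball (0:R) ((`|C| + 1)^-1 * e) z.
    by near: z; apply: (nbhsx_ballx (0:R)); rewrite mulr_gt0// invr_gt0.
  by rewrite /ball /= sub0r normrN => /ltW.
- by rewrite invr0 mulr0.
Unshelve. all: by end_near. Qed.

(** The family [x^-j exp(-1/x)], [x > 0], extended by zero: unlike [exp(-1/x)]
    alone it is closed under differentiation up to linear combinations. *)
Definition flat (j : nat) (x : R) : R :=
  if 0 < x then x ^- j * expR (- x^-1) else 0.

Lemma flat_ge0 j x : 0 <= flat j x.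
Proof.
rewrite /flat; case: ifP => // x0.
by rewrite mulr_ge0 ?expR_ge0// invr_ge0 exprn_ge0// ltW.
Qed.

(** The exponential series gives [exp(1/x) >= x^-(j+2)/(j+2)!].  A quadratic bound
    is what differentiability at the origin requires. *)
Lemma flat_le j x : flat j x <= j.+2`!%:R * x ^+ 2.
Proof.
rewrite /flat; case: ifP => [x0|_]; last by rewrite mulr_ge0 ?sqr_ge0.
have y0 : 0 < x^-1 by rewrite invr_gt0.
have := expR_ge1Dxn j.+1 (ltW y0).
rewrite expRN -exprVn => h.
have {}h : x^-1 ^+ j.+2 <= j.+2`!%:R * expR x^-1.
  rewrite mulrC -ler_pdivrMr ?ltr0n ?fact_gt0//; apply: le_trans h.
  by rewrite lerDr.
rewrite ler_pdivrMr ?expR_gt0// mulrAC.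
have -> : x^-1 ^+ j = x^-1 ^+ j.+2 * x ^+ 2.
  by rewrite -addn2 exprD -mulrA -exprMn mulVf ?expr1n ?mulr1// gt_eqF.
by rewrite ler_wpM2r// sqr_ge0.
Qed.

Lemma is_derive_flat j (x : R) :
  is_derive x (1:R) (flat j) (flat j.+2 x - j%:R * flat j.+1 x).
Proof.
have [x0|x0|<-] := ltgtP 0 x.
- have H : is_derive x (1:R) (fun y : R => y^-1) (- x ^- 2).
    have := @is_deriveV R id x 1 1 (lt0r_neq0 x0) (is_derive_id _ _).
    by rewrite /GRing.scale /= mulr1.
  have H1 : is_derive x (1:R) (fun y : R => y^-1 ^+ j * expR (- y^-1))
     (flat j.+2 x - j%:R * flat j.+1 x).
    have H2 : is_derive x (1:R) (fun y : R => - y^-1) (x ^- 2).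
      by have := is_deriveN H; rewrite opprK.
    have H3 := @is_derive1_comp _ expR (fun y => - y^-1) x _ _ (is_derive_expR (- x^-1)) H2.
    have H4 := @is_deriveX _ _ (fun y : R => y^-1) j x 1 _ H.
    have H5 := is_deriveM H4 H3; rewrite exprfctE in H5.
    apply: is_derive_eq H5 _.
    rewrite /flat x0 /GRing.scale /= -!exprVn.
    by case: j {H4} => [|j] /=; rewrite ?exprS; ring.
  apply: near_eq_is_derive H1.
  near=> y; rewrite /flat ifT ?exprVn//.
  near: y; exact: lt_nbhsr.
- have -> : flat j.+2 x - j%:R * flat j.+1 x = 0.
    by rewrite /flat !ifF ?mulr0 ?subr0// ltNge ltW.
  apply: near_eq_is_derive (is_derive_cst 0 _ _).
  near=> y; rewrite /flat ifF//; apply/negbTE; rewrite -leNgt ltW//.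
  near: y; exact: lt_nbhsl.
- have -> : flat j.+2 0 - j%:R * flat j.+1 0 = 0 by rewrite /flat ltxx mulr0 subr0.
  apply: (is_derive_flat0 (C := j.+2`!%:R)) => y.
  by rewrite ger0_norm ?flat_ge0 ?flat_le.
Unshelve. all: by end_near. Qed.

Lemma diffn_flat n j : diffn n (flat j).
Proof.
elim: n j => //= n IH j.
exists (flat j.+2 + cst (- j%:R) * flat j.+1); last first.
  by apply: diffnD => //; apply: diffnM => //; exact: diffn_cst.
by move=> x; have := is_derive_flat j x; rewrite !fctE/= mulNr.
Qed.

Definition smoothstep (x : R) : R := flat 0 x / (flat 0 x + flat 0 (1 - x)).

Lemma flat_gt0 j x : 0 < x -> 0 < flat j x.
Proof.
by move=> x0; rewrite /flat x0 mulr_gt0 ?expR_gt0// invr_gt0 exprn_gt0.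
Qed.

Lemma flat_eq0 j x : x <= 0 -> flat j x = 0.
Proof. by move=> x0; rewrite /flat ifF// ltNge x0. Qed.

Lemma diffn_smoothstep n : diffn n smoothstep.
Proof.
pose h := (flat 0 + (fun x => flat 0 (-1 * x + 1))).
rewrite (_ : smoothstep = flat 0 * (fun x => (h x)^-1)); last first.
  by apply/funext => x; rewrite /smoothstep /h !fctE mulN1r [1 - x]addrC.
apply: diffnM; first exact: diffn_flat.
apply: diffnV; last by apply: diffnD; [|apply: diffn_affine]; exact: diffn_flat.
move=> x; rewrite /h fctE gt_eqF//.
have [x0|x0] := ltP 0 x.
  by rewrite ltr_pwDl ?flat_gt0// flat_ge0.
by rewrite ltr_wpDl ?flat_ge0// flat_gt0//; lra.
Qed.

Lemma smoothstep0 x : x <= 0 -> smoothstep x = 0.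
Proof. by move=> x0; rewrite /smoothstep flat_eq0// mul0r. Qed.

Lemma smoothstep1 x : 1 <= x -> smoothstep x = 1.
Proof.
move=> x1; rewrite /smoothstep (flat_eq0 _ (x := 1 - x)) ?subr_le0// addr0 divff//.
by rewrite gt_eqF// flat_gt0//; lra.
Qed.

Definition plateau (x : R) : R := smoothstep (x + 1) * smoothstep (2 - x).

Lemma diffn_plateau n : diffn n plateau.
Proof.
rewrite (_ : plateau = (fun x => smoothstep (1 * x + 1)) *
   (fun x => smoothstep (-1 * x + 2))); last first.
  by apply/funext => x; rewrite /plateau !fctE mul1r mulN1r [- x + 2]addrC.
by apply: diffnM; apply: diffn_affine; exact: diffn_smoothstep.
Qed.

Lemma plateau1 x : 0 <= x <= 1 -> plateau x = 1.
Proof. by move=> x01; rewrite /plateau !smoothstep1 ?mulr1//; lra. Qed.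

Lemma plateau0 x : (x <= -1) || (2 <= x) -> plateau x = 0.
Proof.
case/orP=> h; rewrite /plateau; first by rewrite smoothstep0 ?mul0r//; lra.
by rewrite [X in _ * X]smoothstep0 ?mulr0//; lra.
Qed.

Lemma smoothR_derive1n f : smoothR f ->
  forall k x, is_derive x (1:R) (f^`(k)%classic) (f^`(k.+1)%classic x).
Proof.
move=> sf k x.
have : diffn 1 (f^`(k)%classic).
  elim: k 1%N => [|k IH] n //.
  have [g fg gn] := IH n.+1.
  rewrite (_ : f^`(k.+1)%classic = g) //.
  by apply/funext => y; rewrite derive1nS/= derive1E; exact: (@derive_val _ _ _ _ _ _ _ (fg y)).
move=> [g fg _]; rewrite derive1nS derive1E.
by have [h _] := fg x; split.
Qed.

(** All derivatives vanish off [[-1, 2]], where they are bounded by compactness. *)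
Lemma bounded_derive1n f : smoothR f ->
    (forall x, (x <= -1) || (2 <= x) -> f x = 0) ->
  forall k, exists B : R, forall x, `|f^`(k)%classic x| <= B.
Proof.
move=> sf f0 k.
have fk0 : forall x, (x < -1) || (2 < x) -> f^`(k)%classic x = 0.
  elim: k => [|k IH] x h; first by apply: f0; case/orP: h => /ltW ->; rewrite ?orbT.
  rewrite derive1nS derive1E -[RHS](derive_cst (0:R) x (1:R)); apply: near_eq_derive.
  case/orP: h => h; near=> y; rewrite IH//.
    by apply/orP; left; near: y; exact: lt_nbhsl.
  by apply/orP; right; near: y; exact: lt_nbhsr.
have ctn : continuous (fun x => `|f^`(k)%classic x|).
  move=> x; apply: cvg_norm; apply: differentiable_continuous.
  by apply/derivable1_diffP; have [] := smoothR_derive1n sf k x.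
have [|c _ cmax] := @EVT_max R (fun x => `|f^`(k)%classic x|) (-1) 2 _
  (continuous_subspaceT ctn); first lra.
exists `|f^`(k)%classic c| => x.
have [/andP[x1 x2]|] := boolP ((-1 <= x) && (x <= 2)).
  by apply: cmax; rewrite in_itv/= x1.
by rewrite negb_and -!ltNge => /fk0 ->; rewrite normr0.
Unshelve. all: by end_near. Qed.

End smooth_real_functions.

(** * Scalars and their moduli *)

(** What the proof uses of the real and complex numbers.  Completeness is stated
    with moduli, because the norm of a [numFieldType] takes values in the field
    itself. *)
Record admissible_scalars (R : realType) (K : scalarField R) : Prop := {
  of_real_mono : {mono of_real K : x y / x <= y} ;
  modulus_complete : forall a : nat -> K,
    (forall e : R, 0 < e -> exists N, forall m n,
       (N <= m)%N -> (N <= n)%N -> modulus (a m - a n) <= e) ->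
    exists l : K, forall e : R, 0 < e -> exists N, forall n,
       (N <= n)%N -> modulus (a n - l) <= e }.

Section modulus.
Context {R : realType} {K : scalarField R} (hK : admissible_scalars K).
Implicit Types (r : R) (z : K).

Lemma modulus_ge0 z : 0 <= modulus z.
Proof. by rewrite -(of_real_mono hK) rmorph0 modulusE normr_ge0. Qed.

Lemma of_real_inj : injective (of_real K).
Proof. exact: fmorph_inj. Qed.

Lemma modulus_of_real r : modulus (of_real K r) = `|r|.
Proof.
apply: of_real_inj; rewrite modulusE.
have [r0|/ltW r0] := leP 0 r.
  by rewrite !ger0_norm// -(rmorph0 (of_real K)) (of_real_mono hK).
by rewrite !ler0_norm ?rmorphN// -(rmorph0 (of_real K)) (of_real_mono hK).
Qed.

Lemma modulusM z z' : modulus (z * z') = modulus z * modulus z'.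
Proof. by apply: of_real_inj; rewrite rmorphM/= !modulusE normrM. Qed.

Lemma modulusD z z' : modulus (z + z') <= modulus z + modulus z'.
Proof. by rewrite -(of_real_mono hK) rmorphD/= !modulusE ler_normD. Qed.

Lemma modulusN z : modulus (- z) = modulus z.
Proof. by apply: of_real_inj; rewrite !modulusE normrN. Qed.

Lemma modulusBC z z' : modulus (z - z') = modulus (z' - z).
Proof. by rewrite -modulusN opprB. Qed.

Lemma modulusB z z' : modulus (z - z') <= modulus z + modulus z'.
Proof. by rewrite -(modulusN z') modulusD. Qed.

Lemma modulus0 : modulus (0 : K) = 0.
Proof. by apply: of_real_inj; rewrite modulusE normr0 rmorph0. Qed.

Lemma modulus0_eq0 z : modulus z <= 0 -> z = 0.
Proof.
move=> z0; apply/normr0_eq0; rewrite -modulusE.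
by rewrite (_ : modulus z = 0) ?rmorph0//; apply/le_anti; rewrite z0 modulus_ge0.
Qed.

Lemma lt_norm_of_real z r : (`|z| < of_real K r) = (modulus z < r).
Proof. by rewrite -modulusE !lt_neqAle (of_real_mono hK) (inj_eq of_real_inj). Qed.

Lemma of_real_gt0 r : (0 < of_real K r) = (0 < r).
Proof. by rewrite -(rmorph0 (of_real K)) !lt_neqAle (of_real_mono hK) (inj_eq of_real_inj). Qed.

(** The radii of the balls of the scalar field are scalars, but a positive scalar
    is the image of its own modulus. *)
Lemma cvg_modulusP {T : Type} {F : set_system T} {FF : Filter F} (f : T -> K) (l : K) :
  f @ F --> l <-> forall e : R, 0 < e -> \forall t \near F, modulus (f t - l) < e.
Proof.
split=> [/cvgrPdist_lt h e e0|h].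
  have := h (of_real K e); rewrite of_real_gt0 => /(_ e0).
  by apply: filterS => t; rewrite distrC lt_norm_of_real.
apply/cvgrPdist_lt => e e0.
have e1 : e = of_real K (modulus e) by rewrite modulusE gtr0_norm.
rewrite e1 of_real_gt0 in e0.
have := h _ e0; apply: filterS => t.
by rewrite -lt_norm_of_real distrC -e1.
Qed.

End modulus.

(** * The mean value inequality and Taylor's inequality *)

Section mean_value_inequality.
Context {R : realType}.

(** A mean value inequality without derivatives: [rho s t] stands for the distance
    between two values of a function, and only the triangle inequality and a local
    Lipschitz bound matter.  For [e > 0] the set of the [t] with
    [rho a t <= (B + e)(t - a)] contains its supremum [c], and the local bound at
    [c] would extend it beyond [c] if [c < b]. *)
Lemma increment_le (rho : R -> R -> R) (a b B : R) : a <= b ->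
    (forall s t u, rho s u <= rho s t + rho t u) ->
    (forall x, a <= x <= b -> forall e : R, 0 < e -> exists2 d : R, 0 < d &
       forall y, a <= y <= b -> `|y - x| < d ->
         rho x y <= (B + e) * `|y - x| /\ rho y x <= (B + e) * `|y - x|) ->
  rho a b <= B * (b - a).
Proof.
move=> ab tri loc.
suff H : forall e : R, 0 < e -> rho a b <= (B + e) * (b - a).
  apply/ler_addgt0Pl => e e0.
  have ba : 0 < b - a + 1 by lra.
  apply: le_trans (H (e / (b - a + 1)) _) _; first exact: divr_gt0.
  rewrite mulrDl addrC lerD2r -mulrA [_^-1 * _]mulrC ler_piMr ?(ltW e0)//.
  by rewrite ler_pdivrMr// mul1r lerDl.
move=> e e0.
pose A := [set t | a <= t <= b /\ rho a t <= (B + e) * (t - a)].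
have Aa : A a.
  split; first by rewrite lexx.
  have [d d0 /(_ a)] := loc a (introT andP (conj (lexx a) ab)) e e0.
  by rewrite lexx ab subrr normr0 => /(_ isT d0)[].
have ubA : ubound A b by move=> t [/andP[]].
have supA : has_sup A by split; [exists a|exists b].
pose c := sup A.
have ac : a <= c by apply: ub_le_sup => //; exists b.
have cb : c <= b by apply: ge_sup => //; exists a.
have [d d0 hd] := loc c (introT andP (conj ac cb)) e e0.
have [t [/andP[at_ tb] rt] ct] := sup_adherent d0 supA.
have tc : t <= c by apply: ub_le_sup; [exists b|split=> //; rewrite at_ tb].
have Ac : rho a c <= (B + e) * (c - a).
  apply: le_trans (tri a t c) _.
  have [||_ h] := hd t; first by rewrite at_ tb.
    by rewrite ler0_norm; rewrite -/c in ct; lra.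
  apply: le_trans (lerD rt h) _; rewrite ler0_norm; last lra.
  by rewrite -mulrDr (_ : t - a + - (t - c) = c - a)//; ring.
move: cb; rewrite le_eqVlt => /orP[/eqP <-//|cb].
pose y := Num.min b (c + d / 2).
have cy : c < y by rewrite lt_min cb; lra.
have yb : y <= b by rewrite ge_min lexx.
have yd : y <= c + d / 2 by rewrite ge_min lexx orbT.
suff : y <= c by rewrite leNgt cy.
apply: ub_le_sup; first by exists b.
split; first by rewrite yb andbT; lra.
have [||h _] := hd y; first by rewrite yb andbT; lra.
  by rewrite gtr0_norm; lra.
apply: le_trans (tri a c y) _; apply: le_trans (lerD Ac h) _.
by rewrite gtr0_norm ?subr_gt0// -mulrDr (_ : c - a + (y - c) = y - a)//; ring.
Qed.

End mean_value_inequality.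

Section unit_interval.
Context {R : realType}.
Implicit Types x y : unit_interval R.

Lemma set_val01 x : 0 <= set_val x <= 1.
Proof. by have := set_valP x; rewrite /= in_itv. Qed.

Lemma clamp01 (t : R) : (`[0, 1]%classic : set R) (Num.max 0 (Num.min t 1)).
Proof.
by rewrite /= in_itv/= le_max lexx/= ge_max ler01 ge_min lexx orbT.
Qed.

(** Clamping, rather than a partial injection, makes [to01] total and
    1-Lipschitz. *)
Definition to01 (t : R) : unit_interval R := SigSub (mem_set (clamp01 t)).

Lemma to01K (t : R) : 0 <= t <= 1 -> set_val (to01 t) = t.
Proof. by move=> /andP[t0 t1]; change (Num.max 0 (Num.min t 1) = t); rewrite min_l// max_r. Qed.

Lemma set_valK x : to01 (set_val x) = x.
Proof. by apply: val_inj; exact: to01K (set_val01 x). Qed.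

Lemma nbhs01P x (A : set (unit_interval R)) :
  nbhs x A <-> exists2 d : R, 0 < d &
    forall y, `|set_val y - set_val x| < d -> A y.
Proof.
split.
  case=> B [[U oU UB] Bx] BA.
  have : nbhs (set_val x) U.
    by apply: open_nbhs_nbhs; split => //; have : B x := Bx; rewrite -UB.
  move=> /nbhs_ballP[e /= e0 eU]; exists e => // y yx.
  by apply: BA; rewrite -UB; apply: eU; rewrite /ball/= distrC.
move=> [d d0 dA]; exists [set y | `|set_val y - set_val x| < d]; split.
- exists (ball (set_val x) d); first exact: ball_open.
  by apply/seteqP; split=> y /=; rewrite /ball/= distrC.
- by rewrite /= subrr normr0.
- exact: dA.
Qed.

Lemma set_val_inj x y : set_val x = set_val y -> x = y.
Proof. exact: val_inj. Qed.

End unit_interval.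

Section derivatives.
Context {R : realType} {K : scalarField R} (hK : admissible_scalars K).
Implicit Types (x y : unit_interval R) (f g : unit_interval R -> K).

(** Differentiability without quotients, which applies at the endpoints as well as
    inside the interval and does not exclude the point itself. *)
Definition has_deriv01 f (d : K) x := forall e : R, 0 < e -> exists2 r : R, 0 < r &
  forall y, `|set_val y - set_val x| < r ->
    modulus (f y - f x - d * of_real K (set_val y - set_val x)) <=
      e * `|set_val y - set_val x|.

Lemma has_deriv01P f d x :
  has_deriv01 f d x <-> diff_quotient f x @ x^' --> d.
Proof.
have quot y e : y != x ->
  (modulus (diff_quotient f x y - d) <= e) =
  (modulus (f y - f x - d * of_real K (set_val y - set_val x)) <=
      e * `|set_val y - set_val x|).
  move=> yx; have yx0 : set_val y - set_val x != 0.
    by rewrite subr_eq0; apply: contra_neq yx; exact: set_val_inj.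
  have h : of_real K (set_val y - set_val x) != 0 by rewrite fmorph_eq0.
  rewrite -(modulus_of_real hK) -ler_pdivrMr; last first.
    by rewrite (modulus_of_real hK) normr_gt0.
  congr (_ <= _); rewrite -[LHS](mulfK (x := modulus (of_real K (set_val y - set_val x)))).
    by rewrite -modulusM mulrBl divfK.
  by rewrite (modulus_of_real hK) normr_eq0.
rewrite (cvg_modulusP hK); split=> h e e0.
- have [|r r0 hr] := h (e / 2); first exact: divr_gt0.
  apply/nbhs01P; exists r => // y /hr + yx.
  by rewrite -quot//; lra.
- have /nbhs01P[r r0 hr] := h e e0.
  exists r => // y yr; have [->|yx] := eqVneq y x.
    by rewrite !subrr rmorph0 mulr0 subr0 modulus0 normr0 mulr0.
  by rewrite -quot//; exact: ltW (hr y yr yx).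
Qed.

Lemma has_deriv01_continuous f d x : has_deriv01 f d x ->
  forall e : R, 0 < e -> exists2 r : R, 0 < r &
    forall y, `|set_val y - set_val x| < r -> modulus (f y - f x) <= e.
Proof.
move=> h e e0; have [r r0 hr] := h 1 ltr01.
have D0 : 0 < modulus d + 1 by rewrite ltr_wpDl// (modulus_ge0 hK).
exists (Num.min r (e / (modulus d + 1))); first by rewrite lt_min r0 divr_gt0.
move=> y; rewrite lt_min => /andP[/hr yr].
rewrite ltr_pdivlMr// => yd.
rewrite -[f y - f x](subrK (d * of_real K (set_val y - set_val x))).
apply: le_trans (modulusD hK _ _) _.
rewrite modulusM (modulus_of_real hK); nra.
Qed.

(** To give a smooth function is to give the sequence of its derivatives; limits
    and series are easier to take for the whole sequence at once. *)
Definition deriv_tower (F : nat -> unit_interval R -> K) :=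
  forall n x, has_deriv01 (F n) (F n.+1 x) x.

Lemma deriv_tower_smooth01 F : deriv_tower F ->
  F 0%N \in @smooth01 R K /\ forall n, derivn01 n (F 0%N) = F n.
Proof.
move=> hF.
have E n : derivn01 n (F 0%N) = F n.
  elim: n => // n IH; rewrite /derivn01 iterS -/(derivn01 _ _) IH.
  apply/funext => x; rewrite /deriv01.
  by apply: cvg_lim => //; apply/has_deriv01P.
split=> //; apply/asboolP => n x; rewrite E; apply/cvg_ex; exists (F n.+1 x).
exact/has_deriv01P.
Qed.

Lemma smooth01_deriv_tower f : f \in @smooth01 R K ->
  deriv_tower (fun n => derivn01 n f).
Proof.
move=> /asboolP fs n x; apply/has_deriv01P.
rewrite /derivn01 iterS -/(derivn01 _ _) /deriv01.
exact: (fs n x).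
Qed.

Lemma mean_value_le (a b B : R) f (df : unit_interval R -> K) :
  0 <= a -> a <= b -> b <= 1 ->
  (forall x, a <= set_val x <= b -> has_deriv01 f (df x) x) ->
  (forall x, a <= set_val x <= b -> modulus (df x) <= B) ->
  modulus (f (to01 b) - f (to01 a)) <= B * (b - a).
Proof.
move=> a0 ab b1 fdf dfB.
apply: (@increment_le _ (fun s t => modulus (f (to01 t) - f (to01 s)))) => //.
  move=> s t u; rewrite -(subrKA (f (to01 t))) addrC.
  by rewrite (le_trans (modulusD hK _ _))// addrC.
move=> x xab e e0.
have x01 : 0 <= x <= 1 by lra.
have [|r r0 hr] := fdf (to01 x) _ e e0; first by rewrite to01K.
exists r => // y yab yr.
have y01 : 0 <= y <= 1 by lra.
have := hr (to01 y); rewrite !to01K// => /(_ yr) h.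
suff H : modulus (f (to01 y) - f (to01 x)) <= (B + e) * `|y - x|.
  by split => //; rewrite modulusBC.
rewrite -[f _ - f _](subrK (df (to01 x) * of_real K (y - x))).
apply: le_trans (modulusD hK _ _) _; rewrite mulrDl addrC.
apply: lerD => //; rewrite modulusM (modulus_of_real hK) ler_wpM2r//.
by apply: dfB; rewrite to01K.
Qed.

End derivatives.

Section taylor.
Context {R : realType} {K : scalarField R} (hK : admissible_scalars K).
Implicit Types (x y a : unit_interval R) (f g : unit_interval R -> K).

Lemma has_deriv01D f g c d x : has_deriv01 f c x -> has_deriv01 g d x ->
  has_deriv01 (fun y => f y + g y) (c + d) x.
Proof.
move=> hf hg e e0.
have e2 : 0 < e / 2 by exact: divr_gt0.
have [r r0 hr] := hf _ e2; have [s s0 hs] := hg _ e2.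
exists (Num.min r s); first by rewrite lt_min r0.
move=> y; rewrite lt_min => /andP[/hr h1 /hs h2].
rewrite (_ : _ - _ = (f y - f x - c * of_real K (set_val y - set_val x)) +
  (g y - g x - d * of_real K (set_val y - set_val x))); last by ring.
apply: le_trans (modulusD hK _ _) _; apply: le_trans (lerD h1 h2) _.
by rewrite -mulrDl -splitr.
Qed.

Lemma has_deriv01_cst (c : K) x : has_deriv01 (fun=> c) 0 x.
Proof.
move=> e e0; exists 1 => // y _.
by rewrite mul0r subrr subr0 modulus0 mulr_ge0// ltW.
Qed.

Lemma has_deriv01Z (c : K) f d x : has_deriv01 f d x ->
  has_deriv01 (fun y => c * f y) (c * d) x.
Proof.
move=> hf e e0.
have C0 : 0 < modulus c + 1 by rewrite ltr_wpDl// (modulus_ge0 hK).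
have [r r0 hr] := hf _ (divr_gt0 e0 C0); exists r => // y /hr h.
rewrite -mulrA -!mulrBr modulusM.
apply: le_trans (ler_wpM2l (modulus_ge0 hK c) h) _.
rewrite mulrA ler_wpM2r// mulrCA ler_piMr ?(ltW e0)//.
by rewrite ler_pdivrMr// mul1r lerDl.
Qed.

Lemma has_deriv01_sum (I : Type) (r : seq I) (F : I -> unit_interval R -> K)
    (d : I -> K) x : (forall i, has_deriv01 (F i) (d i) x) ->
  has_deriv01 (fun y => \sum_(i <- r) F i y) (\sum_(i <- r) d i) x.
Proof.
move=> h; elim: r => [|i r IH].
  rewrite big_nil (_ : (fun y => _) = fun=> 0); first exact: has_deriv01_cst.
  by apply/funext => y; rewrite big_nil.
rewrite big_cons (_ : (fun y => _) = fun y => F i y + \sum_(j <- r) F j y).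
  exact: has_deriv01D.
by apply/funext => y; rewrite big_cons.
Qed.

Lemma has_deriv01_real (h : R -> R) (d : R) x :
  is_derive (set_val x : R) (1 : R) h d ->
  has_deriv01 (fun y => of_real K (h (set_val y))) (of_real K d) x.
Proof.
move=> /is_derive1_caratheodory[g [hg cg <-]] e e0.
have {}cg : g @ (set_val x : R) --> g (set_val x) := cg.
move/cvgrPdist_le : cg => /(_ e e0) /nbhs_ballP[r /= r0 hr].
exists r => // y yr; rewrite -rmorphB/= hg -rmorphM/= -rmorphB/=.
rewrite (modulus_of_real hK) -mulrBl normrM ler_wpM2r// distrC.
by apply: hr; rewrite /ball/= distrC.
Qed.

(** Induction on the order: the derivative of the remainder is the remainder of
    order one less of the derivative, and the mean value inequality on the segment
    between [a] and [x] gains the factor [|x - a|]. *)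
Lemma taylor_le (F : nat -> unit_interval R -> K) k a x (B : R) :
  deriv_tower F -> (forall y, modulus (F k y) <= B) ->
  modulus (F 0%N x - \sum_(j < k) F j a *
     of_real K ((set_val x - set_val a) ^+ j / j`!%:R)) <=
  B * `|set_val x - set_val a| ^+ k.
Proof.
elim: k F x => [|k IH] F x hF FB.
  by rewrite big_ord0 subr0 expr0 mulr1.
pose phi y := F 0%N y - \sum_(j < k.+1) F j a *
     of_real K ((set_val y - set_val a) ^+ j / j`!%:R).
have phia : phi a = 0.
  rewrite /phi big_ord_recl big1 ?addr0.
    by rewrite expr0 fact0 divr1 rmorph1 mulr1 subrr.
  by move=> i _; rewrite subrr exprS !mul0r rmorph0 mulr0.
pose dphi y := F 1%N y - \sum_(j < k) F j.+1 a *
     of_real K ((set_val y - set_val a) ^+ j / j`!%:R).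
have dphiP y : has_deriv01 phi (dphi y) y.
  rewrite (_ : phi = fun y => (F 0%N y + \sum_(j < k) (- F j.+1 a) *
     of_real K ((set_val y - set_val a) ^+ j.+1 / j.+1`!%:R)) + (- F 0%N a)).
    rewrite (_ : dphi y = F 1%N y + \sum_(j < k) (- F j.+1 a) *
     of_real K ((set_val y - set_val a) ^+ j / j`!%:R) + 0); last first.
      by rewrite addr0 /dphi -sumrN; congr +%R; apply: eq_bigr => i _; rewrite mulNr.
    apply: has_deriv01D; last exact: has_deriv01_cst.
    apply: has_deriv01D; first exact: hF.
    apply: has_deriv01_sum => i; apply: has_deriv01Z.
    apply: (@has_deriv01_real (fun t => (t - set_val a) ^+ i.+1 / i.+1`!%:R)).
    have h1 : is_derive (set_val y : R) (1 : R) (fun t => t - set_val a) 1.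
      have := is_deriveD (is_derive_id (set_val y) (1 : R))
        (is_derive_cst (- set_val a) (set_val y) (1:R)).
      by rewrite addr0.
    have h2 := is_deriveX i.+1 h1.
    have h3 := is_deriveZ (i.+1`!%:R)^-1 h2.
    have E : (i.+1)`!%:R^-1 *: ((fun t : R => t - set_val a) ^+ i.+1) =
       (fun t => (t - set_val a) ^+ i.+1 / i.+1`!%:R).
      by rewrite exprfctE; apply/funext => t; rewrite fctE /GRing.scale/= mulrC.
    rewrite -E; apply: is_derive_eq h3 _.
    rewrite /GRing.scale/= mulr1 factS natrM invfM mulrCA mulrA.
    by rewrite mulVKf ?pnatr_eq0// mulrC.
  apply/funext => z; rewrite /phi big_ord_recl /= expr0 fact0 divr1 rmorph1 mulr1.
  rewrite opprD addrA addrAC; congr (_ + _ - _).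
  by rewrite -sumrN; apply: eq_bigr => i _; rewrite mulNr.
have dphiB y : modulus (dphi y) <= B * `|set_val y - set_val a| ^+ k.
  by apply: (IH (fun n => F n.+1)) => // n z; exact: hF.
rewrite -/(phi x).
have B0 : 0 <= B by apply: le_trans (FB x); exact: (modulus_ge0 hK).
have /andP[a0 a1] := set_val01 a; have /andP[x0 x1] := set_val01 x.
have [ax|/ltW ax] := leP (set_val a) (set_val x).
- have E : `|set_val x - set_val a| = set_val x - set_val a by rewrite ger0_norm ?subr_ge0.
  rewrite exprSr mulrA {2}E.
  have := @mean_value_le _ _ hK (set_val a) (set_val x)
    (B * `|set_val x - set_val a| ^+ k) phi dphi a0 ax x1 (fun y _ => dphiP y).
  rewrite !set_valK phia subr0; apply.
  move=> y /andP[ay yx]; apply: le_trans (dphiB y) _; rewrite ler_wpM2l//.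
  by apply: lerXn2r; rewrite ?nnegrE// !ger0_norm; lra.
- have E : `|set_val x - set_val a| = set_val a - set_val x.
    by rewrite ler0_norm ?subr_le0// opprB.
  rewrite exprSr mulrA {2}E.
  have := @mean_value_le _ _ hK (set_val x) (set_val a)
    (B * `|set_val x - set_val a| ^+ k) phi dphi x0 ax a1 (fun y _ => dphiP y).
  rewrite !set_valK phia sub0r modulusN; apply.
  move=> y /andP[ay yx]; apply: le_trans (dphiB y) _; rewrite ler_wpM2l//.
  by apply: lerXn2r; rewrite ?nnegrE// !ler0_norm; lra.
Qed.

Lemma to01_lipschitz (s t : R) :
  `|set_val (to01 s) - set_val (to01 t)| <= `|s - t|.
Proof.
change (`|Num.max 0 (Num.min s 1) - Num.max 0 (Num.min t 1)| <= `|s - t|).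
have max_lip (u v : R) : `|Num.max 0 u - Num.max 0 v| <= `|u - v|.
  have := ler_norm (u - v); have := ler_norm (v - u); rewrite distrC => h1 h2.
  by rewrite ler_norml; case: (leP 0 u) => ?; case: (leP 0 v) => ?; lra.
have min_lip (u v : R) : `|Num.min u 1 - Num.min v 1| <= `|u - v|.
  have := ler_norm (u - v); have := ler_norm (v - u); rewrite distrC => h1 h2.
  by rewrite ler_norml; case: (leP u 1) => ?; case: (leP v 1) => ?; lra.
exact: le_trans (max_lip _ _) (min_lip _ _).
Qed.

(** The seminorms are suprema of sets of reals, which mean nothing unless these
    sets are bounded. *)
Lemma deriv_bounded f (df : unit_interval R -> K) :
  (forall x, has_deriv01 f (df x) x) ->
  exists B : R, forall x, modulus (f x) <= B.
Proof.
move=> fdf; pose h t := modulus (f (to01 t)).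
have ch : continuous h.
  move=> t; apply/cvgrPdist_le => e e0.
  have [r r0 hr] := has_deriv01_continuous hK (fdf (to01 t)) e0.
  apply/nbhs_ballP; exists r => //= s; rewrite /ball/= => ts.
  have {}hr := hr (to01 s) (le_lt_trans (to01_lipschitz s t) _).
  rewrite distrC in ts; apply: le_trans (hr ts).
  rewrite /h ler_norml; apply/andP; split.
    rewrite -lerN2 opprK opprB.
    by rewrite lerBlDr (le_trans _ (modulusD hK _ _))// subrK.
  by rewrite lerBlDr modulusBC (le_trans _ (modulusD hK _ _))// subrK.
have [c _ hc] := @EVT_max R h 0 1 ler01 (continuous_subspaceT ch).
exists (h c) => x; rewrite -(set_valK x); apply: hc.
by rewrite in_itv/=; exact: set_val01.
Qed.

Lemma le_smooth_seminorm (f : smooth_fun K) k x :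
  modulus (derivn01 k f x) <= smooth_seminorm k f.
Proof.
have [B hB] := deriv_bounded (smooth01_deriv_tower hK (valP f) k).
by apply: ub_le_sup; [exists B => _ [y _ <-]|exists x].
Qed.

Lemma smooth_seminorm_le (f : smooth_fun K) k (B : R) :
  (forall x, modulus (derivn01 k f x) <= B) -> smooth_seminorm k f <= B.
Proof.
move=> h; apply: ge_sup; last by move=> _ [y _ <-].
by exists (modulus (derivn01 k f (to01 0))); exists (to01 0).
Qed.

End taylor.

(** * Series of scalars and of smooth functions *)

Section series.
Context {R : realType} {K : scalarField R} (hK : admissible_scalars K).
Implicit Types (a b : nat -> K) (l : K) (C : R).

Lemma eventually_div_le C (e : R) : 0 < e ->
  exists N : nat, forall n, (N <= n)%N -> C / n.+1%:R <= e.
Proof.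
move=> e0; exists (Num.bound (`|C| / e)) => n Nn.
rewrite ler_pdivrMr ?ltr0n// (le_trans (ler_norm C))// mulrC -ler_pdivrMr//.
have h := archi_boundP (divr_ge0 (normr_ge0 C) (ltW e0)).
by rewrite (le_trans (ltW h))// ler_nat (leq_trans Nn).
Qed.

(** Convergence at the rate [O(1/n)], which is the rate given by the terms
    [O(1/m^2)] met below.  A fixed rate makes sums linear and unique with no
    discussion of limits. *)
Definition has_sum a l := exists C, forall n,
  modulus (\sum_(i < n) a i - l) <= C / n.+1%:R.

Definition ksum a : K := xget 0 [set l | has_sum a l].

(** A summable weight of order [m^-2] whose partial sums telescope. *)
Definition weight (m : nat) : R := (m.+1%:R * m.+2%:R)^-1.

Lemma weight_telescope m : weight m = m.+1%:R^-1 - m.+2%:R^-1.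
Proof.
rewrite /weight -[m.+2]addn1 natrD; field.
have m0 : 0 <= m%:R :> R by [].
by apply/andP; split; rewrite gt_eqF//; lra.
Qed.

Lemma partial_sum_dist a C m n : (forall i, modulus (a i) <= C * weight i) ->
  (m <= n)%N ->
  modulus (\sum_(i < m) a i - \sum_(i < n) a i) <= C * (m.+1%:R^-1 - n.+1%:R^-1).
Proof.
move=> aC; elim: n => [|n IH].
  by rewrite leqn0 => /eqP ->; rewrite !subrr modulus0 mulr0.
rewrite leq_eqVlt => /orP[/eqP ->|mn]; first by rewrite !subrr modulus0 mulr0.
rewrite big_ord_recr/= opprD addrA (le_trans (modulusD hK _ _))// modulusN.
apply: le_trans (lerD (IH mn) (aC n)) _.
by rewrite weight_telescope -mulrDr addrA subrK.
Qed.

Lemma exists_sum a C : (forall i, modulus (a i) <= C * weight i) ->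
  exists l, forall n, modulus (\sum_(i < n) a i - l) <= C / n.+1%:R.
Proof.
move=> aC.
have C0 : 0 <= C.
  have := le_trans (modulus_ge0 hK (a 0%N)) (aC 0%N).
  by rewrite pmulr_lge0// /weight invr_gt0 mulr_gt0.
have dist m n : (m <= n)%N ->
    modulus (\sum_(i < m) a i - \sum_(i < n) a i) <= C / m.+1%:R.
  move=> mn; apply: le_trans (partial_sum_dist aC mn) _.
  by rewrite ler_wpM2l// lerBlDr lerDl invr_ge0.
have [|l hl] := modulus_complete hK (a := fun n => \sum_(i < n) a i).
  move=> e e0; have [N hN] := eventually_div_le C e0.
  exists N => m n Nm Nn; have [mn|/ltnW mn] := leqP m n.
    exact: le_trans (dist _ _ mn) (hN _ Nm).
  by rewrite modulusBC; exact: le_trans (dist _ _ mn) (hN _ Nn).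
exists l => n; apply/ler_addgt0Pl => e e0; have [N hN] := hl e e0.
rewrite -(subrKA (\sum_(i < maxn n N) a i)) (le_trans (modulusD hK _ _))//.
by rewrite addrC lerD ?hN ?leq_maxr// dist// leq_maxl.
Qed.

Lemma has_sum_unique a l l' : has_sum a l -> has_sum a l' -> l = l'.
Proof.
move=> [C hC] [D hD]; apply/eqP; rewrite -subr_eq0; apply/eqP.
apply: (modulus0_eq0 hK); apply/ler_addgt0Pl => e e0; rewrite addr0.
have [N hN] := eventually_div_le (C + D) e0.
apply: le_trans (hN N (leqnn N)).
rewrite -(subrKA (\sum_(i < N) a i)) (le_trans (modulusD hK _ _))//.
by rewrite mulrDl; apply: lerD (hD N); rewrite modulusBC; exact: hC.
Qed.

Lemma ksum_unique a l : has_sum a l -> ksum a = l.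
Proof.
move=> h; apply: (has_sum_unique _ h).
by have := @xgetPex _ (0 : K) [set l | has_sum a l]; apply; exists l.
Qed.

Lemma has_sum_ksum a C : (forall i, modulus (a i) <= C * weight i) ->
  has_sum a (ksum a).
Proof.
move=> /exists_sum[l hl]; have h : has_sum a l by exists C.
by rewrite (ksum_unique h).
Qed.

Lemma has_sum_le a l C : (forall i, modulus (a i) <= C * weight i) ->
  has_sum a l -> modulus l <= C.
Proof.
move=> /exists_sum[l' hl] h; have h' : has_sum a l' by exists C.
rewrite (has_sum_unique h h') -modulusN -sub0r.
by have := hl 0%N; rewrite big_ord0 divr1.
Qed.

Lemma has_sum_linear (c : K) a b l l' : has_sum a l -> has_sum b l' ->
  has_sum (fun i => c * a i + b i) (c * l + l').
Proof.
move=> [C hC] [D hD]; exists (modulus c * C + D) => n.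
rewrite big_split/= -mulr_sumr opprD addrACA -mulrBr.
apply: le_trans (modulusD hK _ _) _; rewrite mulrDl; apply: lerD (hD n).
by rewrite modulusM -mulrA; apply: ler_wpM2l (hC n); exact: modulus_ge0 hK _.
Qed.

Lemma has_sum_finite a N : (forall i, (N <= i)%N -> a i = 0) ->
  has_sum a (\sum_(i < N) a i).
Proof.
move=> a0.
pose u n := modulus (\sum_(i < n) a i - \sum_(i < N) a i).
(* This constant is large enough for each of the N partial sums that may differ
   from the total. *)
exists (\sum_(n < N) u n * n.+1%:R) => n.
have [nN|Nn] := ltnP n N.
  rewrite ler_pdivlMr ?ltr0n// [leRHS](bigD1 (Ordinal nN))//= lerDl.
  by apply: sumr_ge0 => i _; rewrite mulr_ge0// (modulus_ge0 hK).
rewrite (_ : \sum_(i < n) a i = \sum_(i < N) a i).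
  rewrite subrr modulus0 divr_ge0//.
  by apply: sumr_ge0 => i _; rewrite mulr_ge0// (modulus_ge0 hK).
rewrite -(subnKC Nn) big_split_ord/= [X in _ + X]big1 ?addr0// => i _.
by rewrite a0// leq_addr.
Qed.

Lemma tower_shift (F : nat -> unit_interval R -> K) k :
  deriv_tower F -> deriv_tower (fun j => F (k + j)%N).
Proof. by move=> hF n x; rewrite addnS; exact: hF. Qed.

(** Term by term differentiation.  The second order Taylor inequality bounds the
    [m]-th remainder by a multiple of [weight m * |y - x|^2]; summing the
    remainders gives a bound [C |y - x|^2] for the sum, without any exchange of
    limits. *)
Lemma deriv_tower_ksum (T : nat -> nat -> unit_interval R -> K) :
  (forall m, deriv_tower (T m)) ->
  (forall k, exists C, forall m y, modulus (T m k y) <= C * weight m) ->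
  deriv_tower (fun k y => ksum (fun m => T m k y)).
Proof.
move=> hT bT k x e e0.
have hs j y : has_sum (fun m => T m j y) (ksum (fun m => T m j y)).
  by have [C hC] := bT j; apply: (@has_sum_ksum _ C) => m.
have [C hC] := bT k.+2.
have C0 : 0 <= C.
  have := le_trans (modulus_ge0 hK _) (hC 0%N x).
  by rewrite pmulr_lge0// /weight invr_gt0 mulr_gt0.
have C1 : 0 < C + 1 by rewrite ltr_wpDl.
exists (e / (C + 1)); first exact: divr_gt0.
move=> y yx; set d := set_val y - set_val x.
pose rem m := (- of_real K d) * T m k.+1 x + ((-1) * T m k x + T m k y).
have hrem : has_sum rem ((- of_real K d) * ksum (fun m => T m k.+1 x) +
    ((-1) * ksum (fun m => T m k x) + ksum (fun m => T m k y))).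
  by apply: has_sum_linear => //; apply: has_sum_linear.
rewrite (_ : _ - _ = (- of_real K d) * ksum (fun m => T m k.+1 x) +
    ((-1) * ksum (fun m => T m k x) + ksum (fun m => T m k y))); last by ring.
have := has_sum_le (C := C * `|d| ^+ 2) _ hrem.
have dC : C * `|d| ^+ 2 <= e * `|d|.
  rewrite expr2 mulrA ler_wpM2r//.
  have : `|d| * (C + 1) <= e by rewrite -ler_pdivlMr// ltW.
  by apply: le_trans; rewrite mulrC ler_wpM2l// lerDl.
move=> h; apply: le_trans dC; apply: h => m.
have := taylor_le hK x y (tower_shift k (hT m)) (k := 2) (B := C * weight m).
rewrite !big_ord_recl big_ord0 addr0/= addn2 addn0 => h.
rewrite mulrAC; apply: le_trans (h _) => //; rewrite le_eqVlt; apply/orP; left.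
apply/eqP; congr modulus; rewrite /rem /bump/= addn1 expr0 expr1.
rewrite fact0 divr1 (factS 0) fact0 muln1 divr1.
by rewrite rmorph1 -/d; ring.
Qed.

End series.

(** * The norms of rapidly decreasing sequences *)

Section s_space_norms.
Context {R : realType} {K : scalarField R} (hK : admissible_scalars K).

Lemma eventually_bounded (u : nat -> R) N (B : R) :
  (forall n, (N <= n)%N -> u n <= B) -> exists B', forall n, u n <= B'.
Proof.
elim: N B => [|N IH] B h; first by exists B => n; exact: h.
apply: (IH (Num.max B (u N))) => n; rewrite leq_eqVlt => /orP[/eqP <-|Nn].
  by rewrite le_max lexx orbT.
by rewrite le_max h.
Qed.

Lemma le_s_norm (x : s_space K) k n :
  modulus (x n) * n.+1%:R ^+ k <= s_norm k x.
Proof.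
apply: ub_le_sup; last by exists n.
suff [B hB] : exists B : R, forall n, modulus (x n) * n.+1%:R ^+ k <= B.
  by exists B => _ [m _ <-].
have := valP x => /asboolP /(_ k) /(cvg_modulusP hK) /(_ 1 ltr01)[N _ hN].
apply: (@eventually_bounded _ (maxn N 1) (2 ^+ k)) => m.
rewrite geq_max => /andP[/hN/= h m1].
rewrite subr0 modulusM -(rmorph_nat (of_real K)) -rmorphXn/= in h.
rewrite (modulus_of_real hK) ger0_norm ?exprn_ge0// in h.
have : (m.+1%:R : R) ^+ k <= 2 ^+ k * m%:R ^+ k.
  rewrite -exprMn; apply: lerXn2r; rewrite ?nnegrE ?mulr_ge0//.
  by rewrite -natrM ler_nat; lia.
move=> h2; apply: le_trans (ler_wpM2l (modulus_ge0 hK _) h2) _.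
by rewrite mulrCA ler_piMr ?exprn_ge0// ltW.
Qed.

Lemma s_norm_le (x : s_space K) k (B : R) :
  (forall n, modulus (x n) * n.+1%:R ^+ k <= B) -> s_norm k x <= B.
Proof.
by move=> h; apply: ge_sup => [|_ [n _ <-]//]; eexists; exists 0%N.
Qed.

Lemma rapidly_decreasingP (a : nat -> K) :
  (forall k, exists C : R, forall n, modulus (a n) * n.+1%:R ^+ k <= C) ->
  a \in @rapidly_decreasing R K.
Proof.
move=> h; apply/asboolP => k; apply/(cvg_modulusP hK) => e e0.
have [C hC] := h k.+1.
have [N hN] := eventually_div_le C (divr_gt0 e0 (ltr0Sn R 1)).
exists N => // n /= Nn; rewrite subr0 modulusM.
rewrite -(rmorph_nat (of_real K)) -rmorphXn/= (modulus_of_real hK) ger0_norm ?exprn_ge0//.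
apply: le_lt_trans (_ : e / 2 < e); last by lra.
apply: le_trans (hN n Nn); rewrite ler_pdivlMr ?ltr0n//; apply: le_trans (hC n).
rewrite exprSr mulrA ler_wpM2r// ler_wpM2l ?(modulus_ge0 hK)//.
by apply: lerXn2r; rewrite ?nnegrE// ler_nat.
Qed.

End s_space_norms.

(** * The nodes and their self-similarity *)

Section nodes.
Context {R : realType}.

(** The recursion [z_m = (2 (m mod 2) + z_(m div 2))/3] reads the binary digits of
    [m], lowest first, as ternary digits 0 or 2.  It is not structural in [m]; any
    fuel at least [m] gives the same value. *)
Fixpoint node_rec (fuel m : nat) : R :=
  if fuel is f.+1 then ((2 * odd m)%N%:R + node_rec f m./2) / 3 else 0.

Definition node (m : nat) : R := node_rec m m.

Lemma node_rec_fuel f g m : (m <= f)%N -> (m <= g)%N ->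
  node_rec f m = node_rec g m.
Proof.
have rec0 h : node_rec h 0 = 0.
  by elim: h => //= h ->; rewrite addr0 mul0r.
elim: f g m => [|f IH] [|g] m; rewrite ?leqn0.
- by [].
- by move=> /eqP -> _; rewrite !rec0.
- by move=> _ /eqP ->; rewrite !rec0.
- move=> mf mg /=; congr ((_ + _) / _); apply: IH; lia.
Qed.

Lemma node0 : node 0 = 0. Proof. by []. Qed.

Lemma nodeE m : node m = ((2 * odd m)%N%:R + node m./2) / 3.
Proof.
case: m => [|m]; first by rewrite node0 addr0 mul0r.
rewrite [LHS]/=; congr ((_ + _) / _); apply: node_rec_fuel => //.
by rewrite -ltnS; lia.
Qed.

Lemma node01 m : 0 <= node m <= 1.
Proof.
suff H f : 0 <= node_rec f m <= 1 by exact: H.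
by elim: f m => [|f IH] m /=; [lra|have := IH m./2; case: odd => /=; lra].
Qed.

(** The lowest [n] binary digits of an index choose the piece of level [n], and the
    remaining ones the position inside it. *)
Lemma node_shift n J i : (J < 2 ^ n)%N ->
  node (J + 2 ^ n * i) = node J + node i / 3 ^+ n.
Proof.
elim: n J => [|n IH] J.
  by rewrite expn0 ltnS leqn0 => /eqP ->; rewrite mul1n add0n node0 add0r divr1.
rewrite expnS => Jn; rewrite nodeE [node J]nodeE.
rewrite (_ : (J + 2 * 2 ^ n * i)./2 = J./2 + 2 ^ n * i)%N; last lia.
rewrite (_ : odd (J + 2 * 2 ^ n * i) = odd J); last lia.
by rewrite IH; [rewrite exprS; field|lia].
Qed.

(** [node J] is the left endpoint of an interval of length [3^-n] inside
    [[0, 1]]. *)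
Lemma node_le n J : (J < 2 ^ n)%N -> node J <= 1 - 3 ^- n.
Proof.
elim: n J => [|n IH] J.
  by rewrite expn0 ltnS leqn0 => /eqP ->; rewrite node0 expr0 invr1 subrr.
rewrite expnS => Jn; have := IH J./2; rewrite [node J]nodeE exprS invfM => /(_ _)h.
have {h} := h ltac:(lia).
by case: odd => /=; lra.
Qed.

(** Distinct pieces of level [n] are at distance at least [3^-n].  The bounds -1
    and 2 are those of the support of [plateau], applied to the variable that
    rescales the [J]-th piece to [[0, 1]]. *)
Lemma node_sep n J l : (J < 2 ^ n)%N -> (l %% 2 ^ n)%N != J ->
  3 ^+ n * (node l - node J) <= -1 \/ 2 <= 3 ^+ n * (node l - node J).
Proof.
elim: n J l => [|n IH] J l.
  by rewrite expn0 modn1 ltnS leqn0 => /eqP ->.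
rewrite expnS => Jn lJ; rewrite [node J]nodeE [node l]nodeE exprS.
have J2 : (J./2 < 2 ^ n)%N by lia.
have p3 : 1 <= 3 ^+ n :> R by rewrite exprn_ege1//; lra.
have [e|e] := eqVneq (odd l) (odd J).
  have lJ2 : (l./2 %% 2 ^ n)%N != J./2.
    apply: contra_neq lJ => h.
    have := divn_eq l./2 (2 ^ n); rewrite h => h2.
    have -> : l = (l./2 %/ 2 ^ n * (2 * 2 ^ n) + J)%N.
      move: (l./2 %/ 2 ^ n)%N h2 => k h2; nia.
    by rewrite modnMDl modn_small.
  rewrite e (_ : 3 * 3 ^+ n * _ = 3 ^+ n * (node l./2 - node J./2)); last by field.
  exact: IH.
have lt1 := node01 l./2; have J1 := node_le J2; have J0 := node01 J./2.
have hn : 3 ^+ n * 3 ^- n = 1 :> R by rewrite divff// gt_eqF//; lra.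
have [Jo|Je] := boolP (odd J).
- have -> : odd l = false by move: e; rewrite Jo; case: odd.
  left; rewrite /= muln0 muln1; nra.
- have -> : odd l = true by move: e; rewrite (negbTE Je); case: odd.
  right; rewrite /= muln0 muln1; nra.
Qed.

Lemma node_inj : injective node.
Proof.
move=> i j ij; apply/eqP; apply: contraT => nij.
have hi : (i < 2 ^ maxn i j)%N by rewrite (leq_ltn_trans (leq_maxl i j))// ltn_expl.
have hj : (j < 2 ^ maxn i j)%N by rewrite (leq_ltn_trans (leq_maxr i j))// ltn_expl.
have := @node_sep (maxn i j) j i hj; rewrite modn_small// => /(_ nij).
by rewrite ij subrr mulr0 => -[]; lra.
Qed.

Lemma node_cantor m : cantor_set (node m).
Proof.
move=> n _; elim: n m => [|n IH] m; first by rewrite /= in_itv/= node01.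
rewrite nodeE /=; case: (odd m); [right|left]; exists (node m./2) => //.
by rewrite /= muln0 add0r.
Qed.

Lemma node_dense (x : R) n : cantor_step n x ->
  exists2 J, (J < 2 ^ n)%N & node J <= x <= node J + 3 ^- n.
Proof.
elim: n x => [|n IH] x.
  rewrite /= in_itv/= => x01; exists 0%N => //.
  by rewrite node0 expr0 invr1 add0r.
have h3 : 3 ^- n.+1 = 3 ^- n / 3 :> R by rewrite exprSr invfM.
case=> -[y /IH[J Jn Jy] <-].
- exists (J.*2); first by rewrite expnS; lia.
  rewrite nodeE odd_double doubleK muln0 add0r h3.
  by move: (node J) (3 ^- n) Jy => ? ? ?; lra.
- exists (J.*2.+1); first by rewrite expnS; lia.
  rewrite nodeE /= odd_double /= uphalf_double muln1 h3.
  by move: (node J) (3 ^- n) Jy => ? ? ?; lra.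
Qed.

(** Newton polynomials, normalized at the next node. *)
Definition newton q : {poly R} :=
  \prod_(i < q) ((node q - node i)^-1 *: ('X - (node i)%:P)).

Lemma newton_horner q u :
  (newton q).[u] = \prod_(i < q) ((u - node i) / (node q - node i)).
Proof.
rewrite /newton horner_prod; apply: eq_bigr => i _.
by rewrite hornerZ hornerXsubC mulrC.
Qed.

Lemma newton_node0 q i : (i < q)%N -> (newton q).[node i] = 0.
Proof.
move=> iq; rewrite newton_horner (bigD1 (Ordinal iq))//= subrr mul0r.
by rewrite mul0r.
Qed.

Lemma node_sub_neq0 q i : (i < q)%N -> node q - node i != 0.
Proof.
move=> iq; rewrite subr_eq0; apply/eqP => /node_inj qi.
by rewrite qi ltnn in iq.
Qed.

Lemma newton_node1 q : (newton q).[node q] = 1.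
Proof.
by rewrite newton_horner big1// => i _; rewrite divff// node_sub_neq0.
Qed.

Lemma size_newton q : size (newton q) = q.+1.
Proof.
rewrite /newton scaler_prod size_scale ?size_prod_XsubC ?size_enum_ord//.
  by rewrite /index_enum -enumT size_enum_ord.
by rewrite prodf_seq_neq0; apply/allP => i _; rewrite /= invr_eq0 node_sub_neq0.
Qed.

Definition newton_bound q : R := \prod_(i < q) `|node q - node i|^-1.

Lemma newton_bound_ge0 q : 0 <= newton_bound q.
Proof. by apply: prodr_ge0 => i _; rewrite invr_ge0. Qed.

Lemma newton_le q u : 0 <= u <= 1 -> `|(newton q).[u]| <= newton_bound q.
Proof.
move=> u01; rewrite newton_horner normr_prod; apply: ler_prod => i _.
rewrite normr_ge0/= normrM normfV ler_piMl ?invr_ge0//.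
by have := node01 i; rewrite ler_norml; lra.
Qed.

(** A bound for the norm of interpolation at the first [D] nodes, obtained by adding
    one Newton term at a time. *)
Fixpoint lebesgue_bound (D : nat) : R :=
  if D is q.+1 then
    lebesgue_bound q + newton_bound q * (1 + lebesgue_bound q)
  else 0.

Lemma lebesgue_bound_ge0 D : 0 <= lebesgue_bound D.
Proof.
elim: D => //= q IH; rewrite addr_ge0// mulr_ge0 ?newton_bound_ge0//.
by rewrite addr_ge0.
Qed.

Lemma lebesgue_bound_homo : {homo lebesgue_bound : D E / (D <= E)%N >-> D <= E}.
Proof.
apply: homo_leq => // [x y z|q]; first exact: le_trans.
by rewrite /= lerDl mulr_ge0 ?newton_bound_ge0// addr_ge0 ?lebesgue_bound_ge0.
Qed.

End nodes.

(** * Newton interpolation over the pieces *)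

Section lebesgue.
Context {R : realType} {K : scalarField R} (hK : admissible_scalars K).

(** Subtracting the right multiple of the last Newton polynomial lowers the degree
    and does not change the values at the earlier nodes; the multiple itself is read
    off at the last node. *)
Lemma lebesgue_boundP D (P : {poly K}) (eps : R) : 0 <= eps ->
  (size P <= D)%N ->
  (forall i, (i < D)%N -> modulus P.[of_real K (node i)] <= eps) ->
  forall u, 0 <= u <= 1 -> modulus P.[of_real K u] <= lebesgue_bound D * eps.
Proof.
move=> eps0; elim: D P => [|D IH] P sP hP u u01.
  move: sP; rewrite leqn0 size_poly_eq0 => /eqP ->.
  by rewrite horner0 modulus0 mul0r.
pose N := map_poly (of_real K) (newton D).
have NE t : N.[of_real K t] = of_real K (newton D).[t] by rewrite horner_map.
have sN : size N = D.+1 by rewrite size_map_poly size_newton.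
have ND : N`_D != 0.
  by rewrite -[D]/(D.+1.-1) -sN -lead_coefE lead_coef_eq0 -size_poly_eq0 sN.
pose a := P`_D / N`_D; pose Q := P - a *: N.
have sQ : (size Q <= D)%N.
  apply/leq_sizeP => j; rewrite leq_eqVlt coefB coefZ => /orP[/eqP <-|Dj].
    by rewrite divfK// subrr.
  by rewrite !nth_default ?mulr0 ?subrr// ?sN// (leq_trans sP).
have QE t : Q.[of_real K t] = P.[of_real K t] - a * of_real K (newton D).[t].
  by rewrite /Q hornerD hornerN hornerZ NE.
have hQ i : (i < D)%N -> modulus Q.[of_real K (node i)] <= eps.
  by move=> iD; rewrite QE newton_node0// rmorph0 mulr0 subr0 hP// ltnW.
have leQ := IH Q sQ hQ.
have la : modulus a <= (1 + lebesgue_bound D) * eps.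
  have -> : a = P.[of_real K (node D)] - Q.[of_real K (node D)].
    by rewrite QE newton_node1 rmorph1 mulr1 opprB addrC subrK.
  rewrite mulrDl mul1r (le_trans (modulusB hK _ _))// lerD ?hP//.
  by apply: leQ; exact: node01.
have -> : P.[of_real K u] = Q.[of_real K u] + a * of_real K (newton D).[u].
  by rewrite QE subrK.
rewrite (le_trans (modulusD hK _ _))//= mulrDl lerD ?leQ//.
rewrite modulusM (modulus_of_real hK) -mulrA mulrC ler_pM//.
- exact: modulus_ge0.
- exact: newton_le.
Qed.

End lebesgue.

Section stages.
Context {R : realType} {K : scalarField R} (hK : admissible_scalars K).
(* The number of nodes per piece at each stage. *)
Context (d : nat -> nat) (d0 : d 0 = 1%N)
  (dhomo : {homo d : m n / (m <= n)%N}) (dle : forall n, (d n <= n.+1)%N).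

Lemma d_gt0 n : (0 < d n)%N.
Proof. by rewrite -d0 dhomo. Qed.

Lemma stage_exists m : exists n, (m < 2 ^ n * d n)%N.
Proof.
exists m; rewrite (leq_trans (ltn_expl m (isT : 1 < 2)%N))//.
by rewrite leq_pmulr// d_gt0.
Qed.

(** The [2^n d_n] first nodes are [d_n] in each piece of level [n]; an index belongs
    to the first stage at which its node is among these. *)
Definition stage m := ex_minn (stage_exists m).

Lemma stageP m : (m < 2 ^ stage m * d (stage m))%N.
Proof. by rewrite /stage; case: ex_minnP. Qed.

Lemma stage_min m n : (m < 2 ^ n * d n)%N -> (stage m <= n)%N.
Proof. by rewrite /stage; case: ex_minnP => k _ h /h. Qed.

Lemma stage_homo : {homo stage : m n / (m <= n)%N}.
Proof. by move=> m n mn; apply: stage_min; exact: leq_ltn_trans (stageP n). Qed.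

Lemma stage_leP m n : (stage m <= n)%N = (m < 2 ^ n * d n)%N.
Proof.
apply/idP/idP => [h|]; last exact: stage_min.
by rewrite (leq_trans (stageP m))// leq_mul ?dhomo// leq_pexp2l.
Qed.

Lemma stage0 : stage 0 = 0%N.
Proof. by apply/eqP; rewrite -leqn0 stage_leP d0. Qed.

Lemma exp_stage_le m : (2 ^ stage m <= 2 * m.+1)%N.
Proof.
case E : (stage m) => [|n]; first by rewrite expn0; lia.
have : ~~ (stage m <= n)%N by rewrite E ltnn.
rewrite stage_leP -leqNgt expnS leq_pmul2l// => h.
by rewrite ltnW// ltnS (leq_trans _ h)// leq_pmulr// d_gt0.
Qed.

Lemma le_exp_stage m : (m.+1 <= 4 ^ stage m)%N.
Proof.
apply: leq_trans (stageP m) _; rewrite (_ : 4 = 2 * 2)%N// expnMn leq_mul2l.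
by rewrite (leq_trans (dle _) (ltn_expl _ _)) ?orbT.
Qed.

Lemma quot_lt_stage m : (m %/ 2 ^ stage m < d (stage m))%N.
Proof. by rewrite ltn_divLR ?expn_gt0// mulnC stageP. Qed.

(** The value of the [m]-th basis function at the [l]-th node.  The coefficients of
    an expansion only involve these numbers. *)
Definition basis_at m l : R :=
  if (l == m %[mod 2 ^ stage m])%N
  then (newton (m %/ 2 ^ stage m)).[node (l %/ 2 ^ stage m)] else 0.

Lemma modn_shift s n J t : (s <= n)%N -> (J + 2 ^ n * t = J %[mod 2 ^ s])%N.
Proof.
move=> sn; rewrite -(subnKC sn) expnD -mulnA addnC mulnC; exact: modnMDl.
Qed.

Lemma basis_at_lt m l : (l < m)%N -> basis_at m l = 0.
Proof.
move=> lm; rewrite /basis_at; case: eqP => // e.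
apply: newton_node0; have := divn_eq l (2 ^ stage m); have := divn_eq m (2 ^ stage m).
rewrite e; move: (_ %% _)%N => r h1 h2.
by move: lm; rewrite {1}h1 {1}h2 ltn_add2r ltn_pmul2r// expn_gt0.
Qed.

Lemma basis_at_diag m : basis_at m m = 1.
Proof. by rewrite /basis_at eqxx newton_node1. Qed.

(** On a piece of level [n] at least [stage i], the basis function is either zero
    or a Newton polynomial, rescaled by an affine map. *)
Lemma basis_at_poly i n J : (stage i <= n)%N -> (J < 2 ^ n)%N ->
  exists2 p : {poly R}, (size p <= (i %/ 2 ^ stage i).+1)%N &
    forall t, basis_at i (J + 2 ^ n * t) = p.[node t].
Proof.
move=> sn Jn; rewrite /basis_at; set s := stage i in sn *.
have E : (2 ^ n = 2 ^ s * 2 ^ (n - s))%N by rewrite -expnD subnKC.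
case: (boolP (J == i %[mod 2 ^ s])%N) => [Ji|Ji]; last first.
  by exists 0; rewrite ?size_poly0// => t; rewrite modn_shift// (negbTE Ji) horner0.
have Jd : (J %/ 2 ^ s < 2 ^ (n - s))%N.
  by rewrite ltn_divLR ?expn_gt0// mulnC -E.
exists (newton (i %/ 2 ^ s) \Po ((3 ^- (n - s)) *: 'X + (node (J %/ 2 ^ s))%:P)).
  rewrite (leq_trans (size_comp_poly_leq _ _))// size_newton/= ltnS.
  rewrite -[leqRHS]muln1 leq_mul// -subn1 leq_subLR addn1.
  rewrite (leq_trans (size_polyD _ _))// geq_max (leq_trans (size_scale_leq _ _)) ?size_polyX//.
  by rewrite (leq_trans (size_polyC_leq1 _)).
move=> t; rewrite modn_shift// Ji horner_comp hornerD hornerZ hornerX hornerC.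
congr _.[_]; rewrite E -mulnA addnC mulnC divnMDl ?expn_gt0// addnC.
by rewrite node_shift// addrC mulrC.
Qed.

(** The partial sums of the expansion of [v], determined by the condition that the
    first [m] of them interpolate [v] at the first [m] nodes. *)
Fixpoint interp (v : nat -> K) (m : nat) : nat -> K :=
  if m is k.+1 then
    fun l => interp v k l + (v k - interp v k k) * of_real K (basis_at k l)
  else fun=> 0.

Definition coef (v : nat -> K) m : K := v m - interp v m m.

Lemma interp_node v m l : (l < m)%N -> interp v m l = v l.
Proof.
elim: m => // m IH; rewrite ltnS leq_eqVlt => /orP[/eqP ->|lm] /=.
  by rewrite basis_at_diag rmorph1 mulr1 addrC subrK.
by rewrite basis_at_lt// rmorph0 mulr0 addr0 IH.
Qed.

Lemma interpE v m l : interp v m l = \sum_(i < m) coef v i * of_real K (basis_at i l).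
Proof. by elim: m => [|m IH]; rewrite ?big_ord0// big_ord_recr/= -IH. Qed.

Lemma interp_linear (a : K) v w m l :
  interp (fun i => a * v i + w i) m l = a * interp v m l + interp w m l.
Proof.
elim: m l => [|m IH] l /=; first by rewrite mulr0 addr0.
by rewrite !IH; ring.
Qed.

Lemma coef_linear (a : K) v w m :
  coef (fun i => a * v i + w i) m = a * coef v m + coef w m.
Proof. by rewrite /coef interp_linear; ring. Qed.

(** The sum is finite because the basis is triangular. *)
Lemma coef_expansion (x : nat -> K) m :
  coef (fun l => \sum_(i < l.+1) x i * of_real K (basis_at i l)) m = x m.
Proof.
set v := fun l => _.
suff H l : interp v m l = \sum_(i < m) x i * of_real K (basis_at i l).
  by rewrite /coef H /v big_ord_recr/= basis_at_diag rmorph1 mulr1 [_ + x m]addrC addrK.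
elim: m l => [|m IH] l; first by rewrite big_ord0.
rewrite big_ord_recr/= !IH {1}/v big_ord_recr/= basis_at_diag rmorph1 mulr1.
by rewrite [_ + x m]addrC addrK.
Qed.

(** A block of terms of the expansion is polynomial on every piece that is small
    enough for all of them; its degree is that of the terms that live there. *)
Lemma interp_poly v n J D a b : (J < 2 ^ n)%N -> (a <= b)%N ->
  (forall i, (a <= i < b)%N -> (stage i <= n)%N) ->
  (forall i, (a <= i < b)%N -> (J = i %[mod 2 ^ stage i])%N ->
    (i %/ 2 ^ stage i < D)%N) ->
  exists2 P : {poly K}, (size P <= D)%N &
    forall t, interp v b (J + 2 ^ n * t) =
      interp v a (J + 2 ^ n * t) + P.[of_real K (node t)].
Proof.
move=> Jn; elim: b => [|b IH].
  rewrite leqn0 => /eqP -> _ _; exists 0; rewrite ?size_poly0// => t.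
  by rewrite horner0 addr0.
rewrite leq_eqVlt => /orP[/eqP -> _ _|ab hs hD].
  by exists 0; rewrite ?size_poly0// => t; rewrite horner0 addr0.
rewrite ltnS in ab.
have [||P sP hP] := IH ab.
- by move=> i /andP[ai ib]; apply: hs; rewrite ai ltnW.
- by move=> i /andP[ai ib]; apply: hD; rewrite ai ltnW.
have sb : (stage b <= n)%N by apply: hs; rewrite ab leqnn.
have [Jb|Jb] := eqVneq (J %% 2 ^ stage b)%N (b %% 2 ^ stage b)%N.
  have [p sp hp] := basis_at_poly sb Jn.
  exists (P + (v b - interp v b b) *: map_poly (of_real K) p).
    rewrite (leq_trans (size_polyD _ _))// geq_max sP/=.
    rewrite (leq_trans (size_scale_leq _ _))// size_map_poly (leq_trans sp)//.
    by apply: hD Jb; rewrite ab leqnn.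
  by move=> t /=; rewrite hP hp hornerD hornerZ horner_map addrA.
exists P => // t /=; rewrite hP /basis_at ifF ?rmorph0 ?mulr0 ?addr0//.
apply/negbTE; apply: contra_neq Jb => <-.
by rewrite modn_shift.
Qed.

(** The index [m] belongs to stage [n + 1].  On its piece of level [n], the terms of
    the stages up to [n] interpolate [v] with degree less than [d n]; as
    interpolation reproduces [p], what remains of [v] there is at most
    [(1 + lebesgue_bound (d n)) eps].  The earlier terms of stage [n + 1] that live
    on the smaller piece of [m] interpolate this remainder at the preceding nodes of
    that piece, and [coef v m] is the interpolation error at the next node. *)
Lemma coef_le v m n (p : {poly K}) (eps : R) : 0 <= eps -> stage m = n.+1 ->
  (size p <= d n)%N ->
  (forall t, modulus (v (m %% 2 ^ n + 2 ^ n * t)%N - p.[of_real K (node t)]) <= eps) ->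
  modulus (coef v m) <=
    (1 + lebesgue_bound (d n.+1)) * ((1 + lebesgue_bound (d n)) * eps).
Proof.
move=> eps0 mn sp hp.
set J' := (m %% 2 ^ n)%N; pose M := (2 ^ n * d n)%N.
have J'n : (J' < 2 ^ n)%N by rewrite ltn_mod expn_gt0.
have Mm : (M <= m)%N.
  by rewrite leqNgt -stage_leP mn ltnn.
have [||P sP hP] := @interp_poly v n J' (d n) 0 M J'n (leq0n _).
- by move=> i /andP[_ iM]; rewrite stage_leP.
- move=> i /andP[_ iM] _; apply: leq_trans (quot_lt_stage i) _.
  by rewrite dhomo// stage_leP.
pose rho := (1 + lebesgue_bound (d n)) * eps : R.
have hr t : modulus (v (J' + 2 ^ n * t)%N - interp v M (J' + 2 ^ n * t)) <= rho.
  rewrite hP/= add0r -(subrKA p.[of_real K (node t)]).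
  rewrite (le_trans (modulusD hK _ _))// /rho mulrDl mul1r lerD ?hp//.
  rewrite modulusBC -hornerN -hornerD.
  apply: (lebesgue_boundP hK eps0) (node01 t).
    by rewrite (leq_trans (size_polyD _ _))// geq_max sP size_polyN.
  move=> i id; rewrite hornerD hornerN.
  have := hP i; rewrite /= add0r => <-; rewrite interp_node; first exact: hp.
  apply: (@leq_trans (2 ^ n * i.+1)); last by rewrite leq_mul2l id orbT.
  by rewrite mulnS ltn_add2r.
have {}hr l : (l = m %[mod 2 ^ n])%N -> modulus (v l - interp v M l) <= rho.
  move=> lm; have := hr (l %/ 2 ^ n)%N.
  by rewrite /J' -lm addnC mulnC -divn_eq.
set J := (m %% 2 ^ n.+1)%N; set q := (m %/ 2 ^ n.+1)%N.
have Jn : (J < 2 ^ n.+1)%N by rewrite ltn_mod expn_gt0.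
have mE : m = (J + 2 ^ n.+1 * q)%N by rewrite addnC mulnC -divn_eq.
have stM i : (M <= i < m)%N -> stage i = n.+1.
  move=> /andP[Mi im]; apply/eqP; rewrite eqn_leq -{1}mn stage_homo ?(ltnW im)//.
  by rewrite ltnNge stage_leP -leqNgt.
have [||H sH hH] := @interp_poly v n.+1 J q M m Jn Mm.
- by move=> i /stM ->.
- move=> i iM; rewrite (stM i iM) => Ji.
  have /andP[_ im] := iM.
  have := divn_eq i (2 ^ n.+1); rewrite -Ji modn_small// => iE.
  by move: im; rewrite [X in (_ < X)%N]mE {1}iE addnC ltn_add2l mulnC ltn_pmul2l ?expn_gt0.
have Jm t : (J + 2 ^ n.+1 * t = m %[mod 2 ^ n])%N.
  by rewrite modn_shift// [in RHS]mE modn_shift.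
have hHt t : (t < q)%N -> modulus H.[of_real K (node t)] <= rho.
  move=> tq; have l_lt : (J + 2 ^ n.+1 * t < m)%N.
    by rewrite [ltnRHS]mE ltn_add2l ltn_pmul2l ?expn_gt0.
  have := hH t; rewrite interp_node// => vE.
  by have := hr _ (Jm t); rewrite vE addrC addKr.
have rho0 : 0 <= rho.
  by rewrite mulr_ge0// addr_ge0// lebesgue_bound_ge0.
have Hq := lebesgue_boundP hK rho0 sH hHt (node01 q).
rewrite /coef {3}mE hH -mE opprD addrA.
rewrite (le_trans (modulusB hK _ _))// mulrDl mul1r lerD ?hr//.
apply: le_trans Hq _; rewrite ler_wpM2r// lebesgue_bound_homo//.
by rewrite ltnW// /q -mn quot_lt_stage.
Qed.

End stages.

(** * Slowly growing degrees *)

Section slow_growth.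
Context {R : realType} (W : nat -> R).

(** Any quantity [W], however fast it grows, is [O(2^n)] along a sequence that waits
    long enough before each step to the next integer. *)
Fixpoint slow (n : nat) : nat :=
  if n is m.+1 then
    (if W (slow m).+1 <= 2 ^+ m.+1 then (slow m).+1 else slow m)
  else 1.

Lemma slow_homo : {homo slow : m n / (m <= n)%N}.
Proof.
apply: homo_leq => // [? ? ?|n]; first exact: leq_trans.
by rewrite /=; case: ifP.
Qed.

Lemma slow_le n : (slow n <= n.+1)%N.
Proof. by elim: n => //= n IH; case: ifP => _ //; exact: leqW. Qed.

Lemma le_slow n : W (slow n) <= Num.max (W 1) 1 * 2 ^+ n.
Proof.
have c1 : 1 <= Num.max (W 1) 1 by rewrite le_max lexx orbT.
elim: n => [|n IH] /=; first by rewrite expr0 mulr1 le_max lexx.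
case: ifP => [h|_].
  by apply: le_trans h _; rewrite ler_peMl// exprn_ge0.
apply: le_trans IH _; rewrite exprS mulrCA ler_peMl//; last lra.
by rewrite mulr_ge0 ?exprn_ge0//; lra.
Qed.

Lemma lt_exp_bound (r : R) (b : nat) : (1 < b)%N ->
  exists N, forall n, (N <= n)%N -> r < b%:R ^+ n.
Proof.
move=> b1; exists (Num.bound `|r|) => n Nn.
have h := archi_boundP (normr_ge0 r).
apply: le_lt_trans (ler_norm r) _; apply: lt_le_trans h _.
by rewrite -natrX ler_nat (leq_trans Nn)// ltnW// ltn_expl.
Qed.

Lemma slow_unbounded k : exists n, (k <= slow n)%N.
Proof.
elim: k => [|k [n kn]]; first by exists 0%N.
have [|n_gt] := leqP k.+1 (slow n); first by exists n.
have nk : slow n = k by apply/eqP; rewrite eqn_leq kn -ltnS n_gt.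
have [N hN] := @lt_exp_bound (W k.+1) 2 isT.
have [|h] := leqP k.+1 (slow (maxn n N)); first by exists (maxn n N).
have {}h : slow (maxn n N) = k.
  by apply/eqP; rewrite eqn_leq -ltnS h -{1}nk slow_homo// leq_maxl.
exists (maxn n N).+1; rewrite /= h ifT//.
by apply: ltW; apply: hN; rewrite leqW// leq_maxr.
Qed.

End slow_growth.

(** * The basis functions and the two estimates *)

Section profiles.
Context {R : realType}.

(** After rescaling, the basis functions of degree [q] are all the same. *)
Definition profile q (u : R) : R := plateau u * (newton q).[u].

Lemma smoothR_profile q : smoothR (profile q).
Proof. by move=> n; apply: diffnM; [exact: diffn_plateau|exact: diffn_horner]. Qed.

Lemma profile_bounded q k : exists B : R, forall u, `|(profile q)^`(k)%classic u| <= B.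
Proof.
apply: bounded_derive1n; first exact: smoothR_profile.
by move=> x h; rewrite /profile plateau0// mul0r.
Qed.

End profiles.

Section seminorm_continuity.
Context {R : realType} {E F : zmodType} (p : nat -> E -> R) (q : nat -> F -> R).

(** The opens are defined by finitely many seminorms at a time, hence the first step:
    one constant and one index for all [j <= k]. *)
Lemma seminorm_open_preimage (A : E -> F) :
  {morph A : x y / x - y} ->
  (forall k, exists C k', forall x (B : R), 0 <= B ->
     (forall j, (j <= k')%N -> p j x <= B) -> q k (A x) <= C * B) ->
  forall U, seminorm_open q U -> seminorm_open p (A @^-1` U).
Proof.
move=> addA bA U oU x Ux.
have [k [e e0 ke]] := oU _ Ux.
have [C [k' [C0 hC]]] : exists C k', 0 < C /\ forall j x (B : R), (j <= k)%N -> 0 <= B ->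
     (forall j, (j <= k')%N -> p j x <= B) -> q j (A x) <= C * B.
  elim: (k) => [|i [C [k' [C0 hC]]]].
    have [C [k' hC]] := bA 0%N.
    exists (`|C| + 1), k'; split=> [|j z B]; first by rewrite ltr_wpDl.
    rewrite leqn0 => /eqP -> B0 h; apply: le_trans (hC z B B0 h) _.
    by rewrite ler_wpM2r// (le_trans (ler_norm C))// lerDl.
  have [C' [k'' hC']] := bA i.+1.
  exists (C + `|C'|), (maxn k' k''); split=> [|j z B]; first by rewrite ltr_pwDl.
  rewrite leq_eqVlt => /orP[/eqP ->|ji] B0 h.
    apply: le_trans (hC' z B B0 _) _.
      by move=> j' j'k; apply: h; rewrite leq_max j'k orbT.
    by rewrite ler_wpM2r// (le_trans (ler_norm C'))// lerDr ltW.
  apply: le_trans (hC j z B ji B0 _) _.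
    by move=> j' j'k; apply: h; rewrite leq_max j'k.
  by rewrite ler_wpM2r// lerDl.
exists k', (e / (2 * C)); first by rewrite divr_gt0// mulr_gt0.
move=> y hy; apply: ke => j jk.
rewrite -addA; apply: le_lt_trans (_ : e / 2 < e); last lra.
have -> : e / 2 = C * (e / (2 * C)) by field; rewrite gt_eqF.
apply: hC => //; first by rewrite divr_ge0 ?(ltW e0)// mulr_ge0// ltW.
by move=> i ik; rewrite ltW// hy.
Qed.

End seminorm_continuity.

Section basis.
Context {R : realType} {K : scalarField R} (hK : admissible_scalars K).
Context (d : nat -> nat) (d0 : d 0 = 1%N)
  (dhomo : {homo d : m n / (m <= n)%N}) (dle : forall n, (d n <= n.+1)%N)
  (dunb : forall k, exists n, (k <= d n)%N).

Local Notation stage := (stage d0 dhomo).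
Local Notation basis_at := (@basis_at R d d0 dhomo).
Local Notation coef := (@coef R K d d0 dhomo).
Local Notation interp := (@interp R K d d0 dhomo).

Context (C : R) (lebC : forall n, 1 + lebesgue_bound (d n) <= C * 2 ^+ n).

Definition samples (f : unit_interval R -> K) l : K := f (to01 (node l)).

(** The case [2(k+1) <= d n] uses the Taylor polynomial of that order at the left
    endpoint of the piece; the order is twice [k + 1] because [3^(2(k+1))] absorbs
    the factor [4^((k+1)n)] made of [(m+1)^k] and of the two Lebesgue constants.
    The other case concerns finitely many stages, for which the zero polynomial
    suffices. *)
Lemma coef_samples_le k : exists B k', forall (F : smooth_fun K) (N : R), 0 <= N ->
  (forall j, (j <= k')%N -> smooth_seminorm j F <= N) ->
  forall m, modulus (coef (samples F) m) * m.+1%:R ^+ k <= B * N.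
Proof.
pose kk := (2 * k.+1)%N; have [n0 hn0] := dunb kk.
have C1 : 1 <= C.
  have := lebC 0; rewrite expr0 mulr1; apply: le_trans.
  by rewrite lerDl lebesgue_bound_ge0.
exists (1 + C * 2 * C * 4 ^+ k * 4 ^+ n0 ^+ k.+1), kk => F N N0 hN m.
have F0 y : modulus (F y) <= N.
  by have := le_smooth_seminorm hK F 0 y; move/le_trans; apply; exact: hN.
(* The summand 1 of the constant serves the single index of stage 0, and B' the
   later stages; n0 is a stage from which the Taylor polynomial is available. *)
pose B' := C * 2 * C * 4 ^+ k * 4 ^+ n0 ^+ k.+1.
have B'0 : 0 <= B' by rewrite /B' !mulr_ge0 ?exprn_ge0//; lra.
have mle : m.+1%:R <= 4 ^+ stage m :> R by rewrite -natrX ler_nat le_exp_stage.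
case sE : (stage m) => [|n].
  move: mle; rewrite sE expr0 (ler_nat R m.+1 1) ltnS leqn0 => /eqP ->.
  rewrite expr1n mulr1 /coef subr0.
  apply: le_trans (F0 _) _; rewrite ler_peMl//.
  by rewrite lerDl.
rewrite sE in mle.
pose J := (m %% 2 ^ n)%N.
have Jn : (J < 2 ^ n)%N by rewrite ltn_mod expn_gt0.
suff [p [eps [eps0 sp hp heps]]] : exists (p : {poly K}) (eps : R), [/\ 0 <= eps,
    (size p <= d n)%N,
    (forall t, modulus (samples F (J + 2 ^ n * t)%N - p.[of_real K (node t)]) <= eps) &
    4 ^+ n ^+ k.+1 * eps <= 4 ^+ n0 ^+ k.+1 * N].
  have hc := coef_le hK eps0 sE sp hp.
  have {}hc : modulus (coef (samples F) m) <= (C * 2 ^+ n.+1) * ((C * 2 ^+ n) * eps).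
    apply: le_trans hc _; apply: ler_pM => //.
    - by rewrite addr_ge0// lebesgue_bound_ge0.
    - by rewrite mulr_ge0// addr_ge0// lebesgue_bound_ge0.
    - by rewrite ler_wpM2r.
  have mk : m.+1%:R ^+ k <= (4 ^+ n.+1) ^+ k :> R.
    by apply: lerXn2r; rewrite ?nnegrE ?exprn_ge0.
  apply: (@le_trans _ _ ((C * 2 ^+ n.+1) * ((C * 2 ^+ n) * eps) * (4 ^+ n.+1) ^+ k)).
    by apply: ler_pM; rewrite ?(modulus_ge0 hK)// exprn_ge0.
  have E4 : (4 : R) ^+ n = 2 ^+ n * 2 ^+ n by rewrite -exprMn; congr (_ ^+ _); ring.
  have -> : (C * 2 ^+ n.+1) * ((C * 2 ^+ n) * eps) * (4 ^+ n.+1) ^+ k =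
     C * 2 * C * 4 ^+ k * (4 ^+ n ^+ k.+1 * eps).
    have -> : 4 ^+ n ^+ k.+1 = 2 ^+ n * 2 ^+ n * 4 ^+ n ^+ k :> R by rewrite exprS {1}E4.
    have -> : 4 ^+ n.+1 ^+ k = 4 ^+ k * 4 ^+ n ^+ k :> R by rewrite exprS exprMn.
    rewrite [2 ^+ n.+1]exprS.
    by move: (4 ^+ n ^+ k) (4 ^+ k) (2 ^+ n) => ? ? ?; ring.
  apply: le_trans (_ : B' * N <= _); last by rewrite ler_wpM2r// lerDr.
  rewrite /B' -[leRHS]mulrA ler_wpM2l//.
  by rewrite !mulr_ge0 ?exprn_ge0//; lra.
have [kd|kd] := leqP kk (d n); last first.
  exists 0, N; split => //; first by rewrite size_poly0.
    by move=> t; rewrite horner0 subr0 F0.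
  rewrite ler_wpM2r//; apply: lerXn2r; rewrite ?nnegrE ?exprn_ge0//.
  rewrite ler_weXn2l//; first lra.
  rewrite leqNgt; apply/negP => n0n.
  by have := leq_trans hn0 (dhomo (ltnW n0n)); rewrite leqNgt kd.
pose a := to01 (node J) : unit_interval R.
pose p := \poly_(j < kk) (derivn01 j F a * of_real K (3 ^- n ^+ j / j`!%:R)).
exists p, (N * 3 ^- n ^+ kk); split.
- by rewrite mulr_ge0// exprn_ge0// invr_ge0 exprn_ge0.
- exact: leq_trans (size_poly _ _) kd.
- move=> t; pose x : unit_interval R := to01 (node (J + 2 ^ n * t)).
  have := @taylor_le _ _ hK (fun j => derivn01 j F) kk a x N
    (smooth01_deriv_tower hK (valP F)) _.
  have xa : set_val x - set_val a = node t / 3 ^+ n :> R.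
    by rewrite !to01K ?node01// node_shift// addrAC subrr add0r.
  have -> : p.[of_real K (node t)] = \sum_(j < kk) derivn01 j F a *
     of_real K ((set_val x - set_val a) ^+ j / j`!%:R).
    rewrite horner_poly; apply: eq_bigr => j _.
    rewrite xa exprMn -(rmorphXn (of_real K))/= -mulrA -(rmorphM (of_real K))/=.
    congr (_ * of_real K _).
    by rewrite mulrC mulrA.
  move=> h; apply: le_trans (h _) _.
    by move=> y; apply: le_trans (le_smooth_seminorm hK F kk y) _; exact: hN.
  rewrite ler_wpM2l// xa; apply: lerXn2r; rewrite ?nnegrE//.
  have /andP[t0 t1] := @node01 R t.
  rewrite ger0_norm ?divr_ge0 ?exprn_ge0// ler_piMl// invr_ge0 exprn_ge0.
- have k4 : 4 ^+ n ^+ k.+1 * 3 ^- n ^+ kk <= 1 :> R.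
    rewrite /kk exprM -exprMn; apply: exprn_ile1.
      by rewrite mulr_ge0 ?exprn_ge0// invr_ge0 exprn_ge0.
    rewrite -exprVn -exprM mulnC exprM -exprMn; apply: exprn_ile1; lra.
  rewrite mulrCA mulrC; apply: ler_wpM2r => //; apply: le_trans k4 _.
  by rewrite exprn_ege1// exprn_ege1//; lra.
Qed.

Context
  (profC : forall k, exists B : R, forall m u,
     `|(profile (m %/ 2 ^ stage m))^`(k)%classic u| <= B * 2 ^+ stage m).

(** The derivatives of the smooth extension of the [m]-th basis function. *)
Definition basis_tower m k (y : unit_interval R) : K :=
  of_real K (3 ^+ stage m ^+ k * (profile (m %/ 2 ^ stage m))^`(k)%classic
    (3 ^+ stage m * (set_val y - node (m %% 2 ^ stage m)))).

Lemma basis_tower_deriv m : deriv_tower (basis_tower m).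
Proof.
move=> k y.
pose c : R := 3 ^+ stage m; pose b : R := node (m %% 2 ^ stage m).
pose g : R -> R := (profile (m %/ 2 ^ stage m))^`(k)%classic.
pose g' : R -> R := (profile (m %/ 2 ^ stage m))^`(k.+1)%classic.
apply: (has_deriv01_real hK (h := fun t => c ^+ k * g (c * (t - b)))).
have h1 : is_derive (set_val y : R) (1 : R) (fun t => c * (t - b)) c.
  have h0 := is_deriveD (is_derive_id (set_val y) (1 : R))
        (is_derive_cst (- b) (set_val y) (1:R)).
  by have := is_deriveZ c h0; rewrite addr0 /GRing.scale /= mulr1.
have h2 : is_derive (c * (set_val y - b)) (1 : R) g (g' (c * (set_val y - b))).
  exact: (smoothR_derive1n (@smoothR_profile R _)).
have h3 := @is_derive1_comp _ g (fun t => c * (t - b)) _ _ _ h2 h1.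
have h4 := is_deriveZ (c ^+ k) h3.
apply: is_derive_eq h4 _; rewrite /GRing.scale exprSr -mulrA.
by congr (_ * _); rewrite mulrC.
Qed.

(** Within the piece of [m] the plateau is 1; on the other pieces it is 0, by the
    separation of the pieces. *)
Lemma basis_tower_node m l : basis_tower m 0 (to01 (node l)) = of_real K (basis_at m l).
Proof.
rewrite /basis_tower expr0 mul1r to01K ?node01//; congr (of_real K _).
rewrite /basis_at /derive1n /= /profile; set n := stage m.
have Jn : (m %% 2 ^ n < 2 ^ n)%N by rewrite ltn_mod expn_gt0.
case: ifPn => [/eqP lm|lm].
  have h3 : 3 ^+ n * (node l - node (m %% 2 ^ n)) = node (l %/ 2 ^ n) :> R.
    rewrite {1}(divn_eq l (2 ^ n)) lm addnC mulnC node_shift// addrAC subrr add0r.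
    by rewrite mulrCA divff ?mulr1// expf_eq0 pnatr_eq0 andbF.
  by rewrite h3 plateau1 ?mul1r// node01.
have [h|h] := @node_sep R _ _ l Jn lm; by rewrite plateau0 ?mul0r// h ?orbT.
Qed.

Lemma basis_tower_le k : exists B : R, forall m y,
  modulus (basis_tower m k y) <= B * m.+1%:R ^+ (2 * k.+1).
Proof.
have [B hB] := profC k; exists (B * 2 ^+ (2 * k.+1)) => m y.
have B0 : 0 <= B.
  have := le_trans (normr_ge0 _) (hB 0%N 0).
  by rewrite stage0 expr0 mulr1.
rewrite (modulus_of_real hK) normrM ger0_norm ?exprn_ge0//.
set n := stage m.
have c0 : 0 <= 2 ^+ n :> R by rewrite exprn_ge0.
apply: (@le_trans _ _ (3 ^+ n ^+ k * (B * 2 ^+ n))).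
  by rewrite ler_wpM2l ?exprn_ge0// hB.
apply: (@le_trans _ _ (B * (2 ^+ n) ^+ (2 * k.+1))).
  (* 3 <= 4 = 2^2 turns 3^(nk) 2^n into a power of 2^n. *)
  rewrite mulrCA ler_wpM2l// exprM [in leRHS]exprS mulrC.
  apply: ler_pM; rewrite ?exprn_ge0//.
    by rewrite expr2 ler_peMl// exprn_ege1//; lra.
  apply: lerXn2r; rewrite ?nnegrE ?exprn_ge0//.
  by rewrite -exprM mulnC exprM; apply: lerXn2r; rewrite ?nnegrE ?exprn_ge0//; lra.
rewrite -mulrA ler_wpM2l// -exprMn; apply: lerXn2r; rewrite ?nnegrE ?mulr_ge0//.
by rewrite -natrX -natrM ler_nat exp_stage_le.
Qed.

(** Two powers of [m + 1] more than the growth of the basis make the series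
    converge. *)
Lemma expansion_tower_le (x : s_space K) k (B : R) :
  (forall m y, modulus (basis_tower m k y) <= B * m.+1%:R ^+ (2 * k.+1)) ->
  forall m y, modulus (x m * basis_tower m k y) <=
    2 * B * s_norm (2 * k.+1).+2 x * weight m.
Proof.
move=> + m y; move: (2 * k.+1)%N => q hB.
have B0 : 0 <= B.
  have := le_trans (modulus_ge0 hK _) (hB 0%N y).
  by rewrite expr1n mulr1.
rewrite modulusM.
apply: le_trans (ler_wpM2l (modulus_ge0 hK _) (hB m y)) _.
rewrite /weight ler_pdivlMr ?mulr_gt0//.
apply: (@le_trans _ _ (2 * B * (modulus (x m) * m.+1%:R ^+ q.+2))); last first.
  by rewrite ler_wpM2l ?mulr_ge0// le_s_norm.
rewrite !exprSr; set P := m.+1%:R ^+ _.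
have P0 : 0 <= P by rewrite exprn_ge0.
have -> : 2 * B * (modulus (x m) * (P * m.+1%:R * m.+1%:R)) =
  modulus (x m) * (B * P) * (m.+1%:R * (2 * m.+1%:R)) by ring.
rewrite ler_wpM2l ?mulr_ge0 ?(modulus_ge0 hK)// ler_wpM2l//.
by rewrite -natrM ler_nat; lia.
Qed.

Definition expansion_deriv (x : s_space K) k (y : unit_interval R) : K :=
  ksum (fun m => x m * basis_tower m k y).

Lemma has_sum_expansion (x : s_space K) k y :
  has_sum (fun m => x m * basis_tower m k y) (expansion_deriv x k y).
Proof.
have [B hB] := basis_tower_le k.
by apply: (has_sum_ksum hK) => m; exact: expansion_tower_le hB m y.
Qed.

Lemma expansion_deriv_tower (x : s_space K) : deriv_tower (expansion_deriv x).
Proof.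
apply: (@deriv_tower_ksum _ _ hK (fun m k y => x m * basis_tower m k y)).
  by move=> m k y; apply: (has_deriv01Z hK); exact: basis_tower_deriv.
move=> k; have [B hB] := basis_tower_le k.
by exists (2 * B * s_norm (2 * k.+1).+2 x) => m y; exact: expansion_tower_le.
Qed.

Definition expansion (x : s_space K) : smooth_fun K :=
  SmoothFun (proj1 (deriv_tower_smooth01 hK (expansion_deriv_tower x))).

Lemma derivn01_expansion (x : s_space K) k :
  derivn01 k (expansion x) = expansion_deriv x k.
Proof. exact: (proj2 (deriv_tower_smooth01 hK (expansion_deriv_tower x)) k). Qed.

Lemma expansion_linear : linear expansion.
Proof.
move=> a x x'; apply: val_inj; apply/funext => y /=.
apply: (ksum_unique hK).
rewrite [X in has_sum _ X](_ : _ = a * expansion_deriv x 0 y + expansion_deriv x' 0 y)//.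
rewrite (_ : (fun m => _) = fun m => a * (x m * basis_tower m 0 y) + x' m * basis_tower m 0 y).
  by apply: (has_sum_linear hK); exact: has_sum_expansion.
by apply/funext => m; rewrite mulrA -mulrDl.
Qed.

Lemma expansion_le k : exists B k', forall (x : s_space K) (N : R), 0 <= N ->
  (forall j, (j <= k')%N -> s_norm j x <= N) ->
  smooth_seminorm k (expansion x) <= B * N.
Proof.
have [B hB] := basis_tower_le k; exists (2 * B), (2 * k.+1).+2 => x N N0 hN.
have B0 : 0 <= B.
  have := le_trans (modulus_ge0 hK _) (hB 0%N (to01 0)).
  by rewrite expr1n mulr1.
apply: smooth_seminorm_le => y; rewrite derivn01_expansion.
apply: le_trans (has_sum_le hK (expansion_tower_le x hB ^~ y) (has_sum_expansion x k y)) _.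
by rewrite ler_wpM2l ?mulr_ge0// hN.
Qed.

Lemma expansion_node (x : s_space K) l :
  expansion x (to01 (node l)) = \sum_(m < l.+1) x m * of_real K (basis_at m l).
Proof.
rewrite /=; apply: (ksum_unique hK).
rewrite (_ : (fun m => _) = fun m => x m * of_real K (basis_at m l)).
  apply: (has_sum_finite hK (N := l.+1)) => i li.
  by rewrite basis_at_lt ?rmorph0 ?mulr0.
by apply/funext => m; rewrite basis_tower_node.
Qed.

Lemma samples_expansion (x : s_space K) m : coef (samples (expansion x)) m = x m.
Proof.
rewrite -[RHS](coef_expansion d0 dhomo x m); congr (coef _ m).
by apply/funext => l; exact: expansion_node.
Qed.

(** The nodes are dense in the Cantor set and smooth functions are continuous. *)
Lemma smooth_eq_on_cantor (F G : smooth_fun K) :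
  (forall l, F (to01 (node l)) = G (to01 (node l))) ->
  forall x, cantor01 R x -> F x = G x.
Proof.
move=> FG x xX; apply/eqP; rewrite -subr_eq0; apply/eqP.
apply: (modulus0_eq0 hK); apply/ler_addgt0Pl => e e0; rewrite addr0.
have e2 : 0 < e / 2 by exact: divr_gt0.
have [r r0 hr] := has_deriv01_continuous hK (smooth01_deriv_tower hK (valP F) 0 x) e2.
have [s s0 hs] := has_deriv01_continuous hK (smooth01_deriv_tower hK (valP G) 0 x) e2.
pose t := Num.min r s; have t0 : 0 < t by rewrite lt_min r0.
have [n /(_ n (leqnn n)) hn] := @lt_exp_bound R t^-1 3 isT.
have [J Jn /andP[J1 J2]] := @node_dense R (set_val x) n (xX n I).
have nt : 3 ^- n < t by rewrite -[t]invrK ltf_pV2 ?posrE ?invr_gt0// exprn_gt0.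
have close : `|set_val (to01 (node J)) - set_val x| < t.
  rewrite to01K ?node01// ler0_norm; first by lra.
  by lra.
move: close; rewrite lt_min => /andP[/hr h1 /hs h2].
rewrite -(subrKA (F (to01 (node J)))) (le_trans (modulusD hK _ _))//.
rewrite [leRHS]splitr; apply: lerD; first by rewrite modulusBC.
by rewrite FG.
Qed.

Lemma expansion_samples (x : s_space K) (F : smooth_fun K) :
  (forall m, x m = coef (samples F) m) ->
  forall y, cantor01 R y -> expansion x y = F y.
Proof.
move=> xF; apply: smooth_eq_on_cantor => l.
change (expansion x (to01 (node l)) = samples F l).
rewrite expansion_node -(@interp_node R K d d0 dhomo (samples F) l.+1 l)// interpE.
by apply: eq_bigr => m _; rewrite xF.
Qed.

End basis.

(** * The isomorphism *)

Section assembly.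
Context {R : realType} {K : scalarField R} (hK : admissible_scalars K).

(** Everything that has to be [O(2^n)] when evaluated at the number of nodes of
    stage [n]: [B q k] will bound the [k]-th derivative of the profile of degree
    [q]. *)
Definition growth (B : nat -> nat -> R) (D : nat) : R :=
  1 + lebesgue_bound D + \sum_(q < D) \sum_(k < D.+1) `|B q k|.

Lemma growth_le (B : nat -> nat -> R) D q k : (q < D)%N -> (k <= D)%N ->
  `|B q k| <= growth B D.
Proof.
move=> qD kD; rewrite /growth (bigD1 (Ordinal qD))//=.
rewrite (bigD1 (Ordinal (kD : (k < D.+1)%N)))//=.
set s1 := \sum_(i | _) _; set s2 := \sum_(i | _) _.
have s10 : 0 <= s1 by apply: sumr_ge0.
have s20 : 0 <= s2 by apply: sumr_ge0 => i _; apply: sumr_ge0.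
have := @lebesgue_bound_ge0 R D; lra.
Qed.

(** For fixed [k], the profiles to be bounded at stage [n] have degree [q < d n].  If
    [k <= d n] then [growth] controls them; otherwise [q < k], and there are only
    finitely many such profiles. *)
Lemma exists_thresholds : exists (d : nat -> nat) (d0 : d 0 = 1%N)
    (dhomo : {homo d : m n / (m <= n)%N}),
  [/\ forall n, (d n <= n.+1)%N,
      forall k, exists n, (k <= d n)%N &
      exists C : R, (forall n, 1 + lebesgue_bound (d n) <= C * 2 ^+ n) /\
        forall k, exists B : R, forall m u,
          `|(profile (m %/ 2 ^ stage d0 dhomo m))^`(k)%classic u| <=
          B * 2 ^+ stage d0 dhomo m].
Proof.
have hB q := choice (@profile_bounded R q).
pose B q := projT1 (hB q).
have hB' q k u : `|(profile q)^`(k)%classic u| <= B q k by exact: projT2 (hB q) k u.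
pose W := growth B; pose C := Num.max (W 1%N) 1.
exists (slow W), erefl, (@slow_homo _ W).
split; [exact: slow_le|exact: slow_unbounded|].
have C1 : 1 <= C by rewrite le_max lexx orbT.
exists C; split=> [n|k].
  apply: le_trans (le_slow W n); rewrite lerDl.
  by apply: sumr_ge0 => i _; apply: sumr_ge0.
exists (C + \sum_(q < k) `|B q k|) => m u.
set n := stage _ _ m; set q := (m %/ 2 ^ n)%N.
have qn : (q < slow W n)%N by exact: quot_lt_stage.
apply: le_trans (hB' q k u) _; apply: le_trans (ler_norm _) _.
have n1 : 1 <= 2 ^+ n :> R by rewrite exprn_ege1//; lra.
have [kn|kn] := leqP k (slow W n).
  apply: le_trans (growth_le B qn kn) _; apply: le_trans (le_slow W n) _.
  rewrite ler_wpM2r ?(le_trans ler01 n1)// lerDl.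
  by apply: sumr_ge0.
have qk := ltn_trans qn kn.
rewrite (bigD1 (Ordinal qk))//= addrCA mulrDl.
rewrite -[leLHS]addr0 lerD//; first by rewrite ler_peMr.
rewrite mulr_ge0 ?(le_trans ler01 n1)// addr_ge0 ?(le_trans ler01 C1)//.
by apply: sumr_ge0.
Qed.

Definition cantor_node l : cantor01 R :=
  SigSub (mem_set (let: h := @node_cantor R l in
    eq_ind_r (fun t => cantor_set t) h (to01K (node01 l)) : cantor01 R (to01 (node l)))).

Theorem C_infty_cantor_homeomorphic_s :
  linearly_homeomorphic (C_infty K (cantor01 R)) (s_space K).
Proof.
have [d [d0 [dhomo [dle dunb [C [lebC profC]]]]]] := exists_thresholds.
pose values (f : C_infty K (cantor01 R)) l : K := f (cantor_node l).
have lift (f : C_infty K (cantor01 R)) : exists F : smooth_fun K, f = to_C_infty _ F.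
  have /asboolP[F hF] := valP f; exists F; exact: val_inj.
pose c f := coef d0 dhomo (values f).
have c_rapid f : c f \in @rapidly_decreasing R K.
  have [F ->] := lift f; apply: (rapidly_decreasingP hK) => k.
  have [B [k' hB]] := coef_samples_le hK d0 dhomo dle dunb lebC k.
  pose N := \sum_(j < k'.+1) smooth_seminorm j F.
  have s0 j : 0 <= smooth_seminorm j F.
    apply: le_trans (le_smooth_seminorm hK F j (to01 0)); exact: modulus_ge0 hK _.
  exists (B * N); apply: hB => [|j jk]; first exact: sumr_ge0.
  by rewrite /N (bigD1 (Ordinal (jk : (j < k'.+1)%N)))//= lerDl sumr_ge0.
pose T0 f : s_space K := SSpace (c_rapid f).
have T0lin : linear T0.
  move=> a f g; apply: val_inj; apply/funext => m.
  exact: (coef_linear d0 dhomo a (values f) (values g) m).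
pose S0 (x : s_space K) : C_infty K (cantor01 R) :=
  to_C_infty _ (expansion hK profC x).
have S0lin : linear S0.
  move=> a x y; rewrite /S0 expansion_linear; apply: val_inj.
  by apply/funext.
pose T : {linear C_infty K (cantor01 R) -> s_space K} :=
  HB.pack T0 (GRing.isLinear.Build _ _ _ _ T0 T0lin).
pose S : {linear s_space K -> C_infty K (cantor01 R)} :=
  HB.pack S0 (GRing.isLinear.Build _ _ _ _ S0 S0lin).
exists T, S; split.
- move=> f; have [F fF] := lift f; apply: val_inj; apply/funext => y.
  rewrite [in RHS]fF /=.
  apply: (expansion_samples hK profC (F := F)); last exact: set_valP.
  by move=> m; rewrite /= /c fF.
- move=> x; apply: val_inj; apply/funext => m.
  exact: samples_expansion.
- apply/continuousP => U oU.
  have A_additive : {morph (fun F : smooth_fun K => T (to_C_infty _ F)) : F G / F - G}.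
    by move=> F G; rewrite -linearB; congr (T _); apply: val_inj; apply/funext.
  apply: (seminorm_open_preimage A_additive _ oU) => k.
  have [B [k' hB]] := coef_samples_le hK d0 dhomo dle dunb lebC k.
  exists B, k' => F N N0 hN; apply: s_norm_le => m.
  exact: hB.
- apply/continuousP => U oU.
  have A_additive : {morph expansion hK profC : x y / x - y}.
    move=> x y; have := expansion_linear hK profC (-1) y x.
    by rewrite !scaleN1r => h; rewrite addrC h addrC.
  apply: (seminorm_open_preimage A_additive _ oU) => k.
  exact: expansion_le.
Qed.

End assembly.

(** * Real and complex scalars *)

Lemma real_modulus_complete (R : realType) (a : nat -> R) :
  (forall e : R, 0 < e -> exists N, forall m n,
     (N <= m)%N -> (N <= n)%N -> `|a m - a n| <= e) ->
  exists l : R, forall e : R, 0 < e -> exists N, forall n,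
     (N <= n)%N -> `|a n - l| <= e.
Proof.
move=> ca.
have /cvg_ex[l al] : cvg (a @ \oo).
  apply: cauchy_cvg; apply: cauchy_exP => e e0.
  have [N hN] := ca (e / 2) (divr_gt0 e0 (ltr0Sn _ 1)).
  exists (a N); exists N => // n /= Nn; rewrite /ball/=.
  by apply: le_lt_trans (hN _ _ (leqnn N) Nn) _; lra.
exists l => e e0; have /cvgrPdist_le/(_ e e0)[N _ hN] := al.
by exists N => n Nn; rewrite distrC; exact: hN.
Qed.

Lemma real_scalars_admissible (R : realType) : admissible_scalars (real_scalars R).
Proof. by split=> // a; exact: real_modulus_complete. Qed.

Lemma Re_le_normc (R : realType) (z : R[i]) : `|complex.Re z| <= modulus (z : complex_scalars R).
Proof.
case: z => x y; rewrite /= -sqrtr_sqr ler_wsqrtr// lerDl; exact: sqr_ge0.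
Qed.

Lemma Im_le_normc (R : realType) (z : R[i]) : `|complex.Im z| <= modulus (z : complex_scalars R).
Proof.
case: z => x y; rewrite /= -sqrtr_sqr ler_wsqrtr// lerDr; exact: sqr_ge0.
Qed.

Lemma normc_le_ReIm (R : realType) (z : R[i]) :
  modulus (z : complex_scalars R) <= `|complex.Re z| + `|complex.Im z|.
Proof.
case: z => x y; rewrite /= -[leRHS]ger0_norm ?addr_ge0// -sqrtr_sqr ler_wsqrtr//.
rewrite sqrrD !real_normK ?num_real// -addrA lerD2l lerDr.
by rewrite mulrn_wge0// mulr_ge0.
Qed.

Lemma complex_scalars_admissible (R : realType) : admissible_scalars (complex_scalars R).
Proof.
split=> [x y|a ca]; first exact: lecR.
have [r hr] : exists r : R, forall e : R, 0 < e -> exists N, forall n,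
     (N <= n)%N -> `|complex.Re (a n) - r| <= e.
  apply: real_modulus_complete => e e0; have [N hN] := ca e e0; exists N => m n Nm Nn.
  by apply: le_trans (hN m n Nm Nn); apply: le_trans (Re_le_normc _); rewrite raddfB.
have [s hs] : exists s : R, forall e : R, 0 < e -> exists N, forall n,
     (N <= n)%N -> `|complex.Im (a n) - s| <= e.
  apply: real_modulus_complete => e e0; have [N hN] := ca e e0; exists N => m n Nm Nn.
  by apply: le_trans (hN m n Nm Nn); apply: le_trans (Im_le_normc _); rewrite raddfB.
exists (Complex r s) => e e0.
have e2 : 0 < e / 2 by exact: divr_gt0.
have [N hN] := hr _ e2; have [M hM] := hs _ e2.
exists (maxn N M) => n; rewrite geq_max => /andP[/hN h1 /hM h2].
apply: le_trans (normc_le_ReIm _) _; rewrite [leRHS]splitr.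
by rewrite !raddfB; exact: lerD.
Qed.

Theorem theorem3p1 (R : realType) :
  linearly_homeomorphic
    (C_infty (real_scalars R) (cantor01 R)) (s_space (real_scalars R)) /\
  linearly_homeomorphic
    (C_infty (complex_scalars R) (cantor01 R)) (s_space (complex_scalars R)).
Proof.
split; apply: C_infty_cantor_homeomorphic_s.
- exact: real_scalars_admissible.
- exact: complex_scalars_admissible.
Qed.
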